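(* There is an absolute constant $c>0$ such that the following holds. Let $H$ be a Hamiltonian on $n$ qubits, $\beta>0$, $\rho=e^{-\beta H}/\mathrm{Tr}[e^{-\beta H}]$. For every full-rank state $\sigma$ and every Hermitian jump operator $A^a$ (with the quantities below defined in the context), $$\mathsf{ADB}_a[\sigma]\le c\;\mathsf{FI}_a[\sigma\|\rho]\left(1+\log\left(\frac{\|\log\sigma-\log\rho\|^2\,\|A^a\|^2}{\mathsf{FI}_a[\sigma\|\rho]}\right)\right),$$ where the right-hand side is read as $0$ if $\mathsf{FI}_a[\sigma\|\rho]=0$.
   Context: $0<\kappa\le1/\beta$ is a Gaussian width. With $f(t)=e^{-\kappa^2t^2}\sqrt{\kappa\sqrt{2/\pi}}$, for an operator $A$ put $\hat A(\omega)=\frac1{\sqrt{2\pi}}\int_{-\infty}^\infty e^{iHt}Ae^{-iHt}e^{-i\omega t}f(t)\,dt$ and $\hat A(\omega,t)=e^{iHt}\hat A(\omega)e^{-iHt}$. $\|\cdot\|$ is the operator norm, $\|\cdot\|_2$ the Hilbert–Schmidt norm, and $\|X\|_{\sigma,s}^2=\mathrm{Tr}[X^\dagger\sigma^{\frac12+s}X\sigma^{\frac12-s}]$. Approximate detailed balance error: $$\mathsf{ADB}_a[\sigma]=\iint_{-\infty}^\infty\Big\|\hat A^a(\omega,t)\sqrt\sigma-\sqrt\sigma\,\rho^{-\frac12}\hat A^a(\omega,t)\rho^{\frac12}\Big\|_2^2\,\gamma(\omega)g(t)\,d\omega\,dt,$$ with $\gamma(\omega)=\exp(-\beta\max(\omega+\beta\kappa^2/2,0))$,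 $g(t)=\frac1{\beta\cosh(2\pi t/\beta)}$. Fisher information: $$\mathsf{FI}_a[\sigma\|\rho]=\iint_{-\infty}^\infty\int_{-1/2}^{1/2}\big\|[\hat A^a(\omega,t),\log\sigma-\log\rho]\big\|_{\sigma,s}^2\,h_s(\omega)g_s(t)\,ds\,d\omega\,dt,$$ with $h(\omega)=e^{-\kappa^2\beta^2/8}e^{-\beta|\omega|/2}$, $h_s(\omega)=\exp\big(\tfrac{s\beta(2\omega-s\beta\kappa^2)}2\big)h(\omega-s\beta\kappa^2)$, $g_s(t)=\frac2\beta\frac{\cos(s\pi)\cosh(2\pi t/\beta)}{\cosh(4\pi t/\beta)+\cos(2s\pi)}$. *)

(* Defs.v *)
From HB Require Import structures.
From mathcomp Require Import all_boot all_order all_algebra.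
From mathcomp Require Import all_classical all_reals all_analysis.
From mathcomp Require Import complex.

Set Implicit Arguments.
Unset Strict Implicit.
Unset Printing Implicit Defensive.

Import Order.TTheory GRing.Theory Num.Theory.
Import numFieldNormedType.Exports.

Local Open Scope classical_set_scope.
Local Open Scope sesquilinear_scope.
Local Open Scope complex_scope.
Local Open Scope ring_scope.

Section Defs.
Context {R : realType}.

Local Notation mu := (@lebesgue_measure R).

(* Functional calculus: [phi] is applied to the eigenvalues of [X].  It is only
   used for Hermitian [X] (where it does not depend on the eigenbasis chosen by
   [spectralmx]); the eigenvalues are then real, so [complex.Re] loses nothing. *)
Definition mxfun N (phi : R -> R[i]) (X : 'M[R[i]]_N) : 'M[R[i]]_N :=
  invmx (spectralmx X)
    *m diag_mx (map_mx (fun z => phi (complex.Re z)) (spectral_diag X))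
    *m spectralmx X.

Definition mxpow N (X : 'M[R[i]]_N) (r : R) : 'M[R[i]]_N :=
  mxfun (fun x => (x `^ r)%:C) X.

Definition mxln N (X : 'M[R[i]]_N) : 'M[R[i]]_N := mxfun (fun x => (ln x)%:C) X.

Definition cis (x : R) : R[i] := cos x +i* sin x.

(* e^{iHt} *)
Definition evol N (H : 'M[R[i]]_N) (t : R) : 'M[R[i]]_N :=
  mxfun (fun x => cis (x * t)) H.

Definition gibbs N (beta : R) (H : 'M[R[i]]_N) : 'M[R[i]]_N :=
  let E := mxfun (fun x => (expR (- beta * x))%:C) H in (\tr E)^-1 *: E.

Definition is_state N (sigma : 'M[R[i]]_N) : Prop :=
  [/\ sigma \is hermsymmx,
      forall v : 'cV[R[i]]_N, 0 <= (v ^t* *m sigma *m v) ord0 ord0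
    & \tr sigma = 1].

Definition full_rank_state N (sigma : 'M[R[i]]_N) : Prop :=
  is_state sigma /\ \rank sigma = N.

(* Hilbert-Schmidt norm; on column vectors it is the Euclidean norm. *)
Definition hsnorm m n (X : 'M[R[i]]_(m, n)) : R :=
  Num.sqrt (complex.Re (\tr (X ^t* *m X))).

Definition opnorm N (X : 'M[R[i]]_N) : R :=
  sup [set hsnorm (X *m v) | v in [set v : 'cV[R[i]]_N | hsnorm v <= 1]].

(* ||X||_{sigma,s}^2; the trace is real (and nonnegative) for positive
   definite [sigma]. *)
Definition sqnorm N (sigma : 'M[R[i]]_N) (s : R) (X : 'M[R[i]]_N) : R :=
  complex.Re (\tr (X ^t* *m mxpow sigma (2^-1 + s) *m X
                      *m mxpow sigma (2^-1 - s))).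

Definition commutator N (X Y : 'M[R[i]]_N) : 'M[R[i]]_N := X *m Y - Y *m X.

Definition mxintegral N (F : R -> 'M[R[i]]_N) : 'M[R[i]]_N :=
  \matrix_(i, j)
    (Rintegral mu setT (fun t => complex.Re (F t i j))
     +i* Rintegral mu setT (fun t => complex.Im (F t i j))).

Definition cosh (x : R) : R := (expR x + expR (- x)) / 2.

Definition filter_f (kappa t : R) : R :=
  expR (- (kappa ^+ 2 * t ^+ 2)) * Num.sqrt (kappa * Num.sqrt (2 / pi)).

Definition Ahat N (kappa : R) (H A : 'M[R[i]]_N) (omega : R) : 'M[R[i]]_N :=
  ((Num.sqrt (2 * pi))^-1)%:C *: mxintegral (fun t =>
    (cis (- (omega * t)) * (filter_f kappa t)%:C)
      *: (evol H t *m A *m evol H (- t))).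

Definition Ahat_t N (kappa : R) (H A : 'M[R[i]]_N) (omega t : R) :
    'M[R[i]]_N :=
  evol H t *m Ahat kappa H A omega *m evol H (- t).

Definition gamma_w (beta kappa omega : R) : R :=
  expR (- (beta * Num.max (omega + beta * kappa ^+ 2 / 2) 0)).

Definition g_w (beta t : R) : R := (beta * cosh (2 * pi * t / beta))^-1.

Definition h_w (beta kappa omega : R) : R :=
  expR (- (kappa ^+ 2 * beta ^+ 2 / 8)) * expR (- (beta * `|omega| / 2)).

Definition hs_w (beta kappa s omega : R) : R :=
  expR (s * beta * (2 * omega - s * beta * kappa ^+ 2) / 2)
    * h_w beta kappa (omega - s * beta * kappa ^+ 2).

Definition gs_w (beta s t : R) : R :=
  2 / beta * (cos (s * pi) * cosh (2 * pi * t / beta)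
              / (cosh (4 * pi * t / beta) + cos (2 * s * pi))).

(* The integrands of [ADB] and [FI] are nonnegative, so both are meaningful as
   extended-real Lebesgue integrals without any integrability assumption. *)
Definition ADB N (beta kappa : R) (H A sigma : 'M[R[i]]_N) : \bar R :=
  let rho := gibbs beta H in
  \int[mu]_t \int[mu]_omega
    (hsnorm (Ahat_t kappa H A omega t *m mxpow sigma 2^-1
             - mxpow sigma 2^-1 *m (mxpow rho (- 2^-1)
                 *m Ahat_t kappa H A omega t *m mxpow rho 2^-1)) ^+ 2
     * gamma_w beta kappa omega * g_w beta t)%:E.

Definition FI N (beta kappa : R) (H A sigma : 'M[R[i]]_N) : \bar R :=
  let rho := gibbs beta H in
  \int[mu]_t \int[mu]_omega
    \int[mu]_(s in `[(- 2^-1 : R)%R, (2^-1 : R)%R])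
      (sqnorm sigma s
         (commutator (Ahat_t kappa H A omega t) (mxln sigma - mxln rho))
       * hs_w beta kappa s omega * gs_w beta s t)%:E.

End Defs.

(* Main.v *)
(* Put K = log sigma - log rho and Y(s) = sigma^{1/4+s/2} [e^{s beta H/2} Ahat(w,t) e^{-s beta H/2}, K]
   sigma^{1/4-s/2}.  As the filter is Gaussian, conjugating Ahat(w,t) by e^{s beta H/2} amounts to
   shifting w by s beta kappa^2 and rescaling; this gives, after translations in w,
     FI = int int int h(w) g_s(t) ||Y(s)||^2  and, by Duhamel's formula,
     ADB = 1/4 int int h(w) g(t) ||int_{-1/2}^{1/2} Y(s) ds||^2.
   Since g_s >= cos(pi s) g, Cauchy-Schwarz with the weight (1+d)^2 - 4 s^2 <= 4 cos(pi s) + 2d + d^2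
   bounds ADB by l(d) (FI + (d + d^2/2) M), where M = ||K||^2 ||A||^2 and l(d), the integral of the
   inverse weight, is logarithmic in 1/d; the d-part uses Parseval's identity in w.  The same estimates
   give FI <= 2M with 2 < e, so that 1 + log(M/FI) stays bounded below, and d = FI/M concludes. *)

Require Import Defs.
From mathcomp Require Import all_boot all_order all_algebra.
From mathcomp Require Import all_classical all_reals all_analysis.
From mathcomp Require Import complex.
From mathcomp Require Import measurable_realfun ring lra.

Set Implicit Arguments.
Unset Strict Implicit.
Unset Printing Implicit Defensive.

Import Order.TTheory GRing.Theory Num.Theory.
Import numFieldNormedType.Exports.

Local Open Scope classical_set_scope.
Local Open Scope sesquilinear_scope.
Local Open Scope complex_scope.
Local Open Scope ring_scope.

(** * Fourier transform of the Gaussian *)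

Section GaussFourier.
Context {R : realType}.
Local Notation mu := (@lebesgue_measure R).

(** The obstacle sits at s = 1/2 and s = -1/2. The best constant in g_s >= c g is cos(pi s), the
    limit of g_s/g for large t, and Cauchy-Schwarz against it would need the integral of 1/cos(pi
    s), which diverges logarithmically. The parameter d moves the zeros of the weight out of the
    interval, and the excess weight is paid for by the crude bound in M. The weight is quadratic
    because its inverse then has an elementary antiderivative. Although sigma and rho need not
    commute, mixed coordinates diagonalize everything at once: an entry in the eigenbasis of sigma
    is split further by pairs of energy levels of H. Powers of sigma and rho and the commutator with
    K then act by scalars, and both functionals become real forms sum_k a_k (sum_j b_kj G(w -
    nu_j))^2 with a Gaussian G. The analytic half treats only such forms; what it assumes about
    matrices is one bound, uniform in tau, for the form with G(w - nu_j) replaced by e^{i nu_j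
    tau}. *)

Lemma Rintegral_derivative_eq0 (F g : R -> R) :
  continuous g -> mu.-integrable setT (EFin \o g) ->
  (forall x : R, is_derive x 1 F (g x)) ->
  F n%:R @[n --> \oo] --> (0 : R) -> F (- n%:R) @[n --> \oo] --> (0 : R) ->
  \int[mu]_x g x = 0.
Proof.
move=> cg ig dF Fy FNy.
(* The successor keeps the interval nondegenerate at n = 0, as [continuous_FTC2] requires. *)
pose f_ (n : nat) := (EFin \o g) \_ `[- n.+1%:R, n.+1%:R].
have int_f n : (\int[mu]_x f_ n x = (F n.+1%:R - F (- n.+1%:R))%:E)%E.
  rewrite -integral_mkcond EFinB.
  apply: continuous_FTC2.
  - by rewrite (@lt_trans _ _ 0) ?oppr_lt0.
  - exact: continuous_subspaceT.
  - split.
    + by move=> x _; have [] := dF x.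
    + apply: cvg_at_right_filter; apply/differentiable_continuous/derivable1_diffP.
      by have [] := dF (- n.+1%:R).
    + apply: cvg_at_left_filter; apply/differentiable_continuous/derivable1_diffP.
      by have [] := dF n.+1%:R.
  - by move=> x _; rewrite derive1E; apply: derive_val.
have cv : (\int[mu]_x f_ n x)%E @[n --> \oo] --> (\int[mu]_x (g x)%:E)%E.
  apply: (@dominated_cvg _ _ _ mu setT _ f_ (EFin \o g)
            (fun x => `|g x|%:E)) => //.
  - move=> n; rewrite /f_ restrict_EFin patch_indic.
    apply/measurable_EFinP; apply: measurable_funM; last exact: measurable_indic.
    exact: continuous_measurable_fun.
  - move=> x _; apply: cvg_near_cst.
    near=> n; rewrite /f_ patchE ifT // inE /= in_itv /= -ler_norml.
    apply: (@le_trans _ _ n%:R); last by rewrite ler_nat.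
    by near: n; apply: nbhs_infty_ger.
  - exact: (@integrable_norm _ _ _ mu _ g).
  - move=> n x _; rewrite /f_ patchE; case: ifP => _ /=.
      by rewrite lee_fin.
    by rewrite normr0 lee_fin.
have cv0 : (\int[mu]_x f_ n x)%E @[n --> \oo] --> (0%:E : \bar R).
  under eq_cvg do rewrite int_f.
  apply: cvg_EFin; first exact: nearW.
  rewrite -[0]subr0; apply: cvgB.
    by move: Fy; rewrite -(cvg_shiftS (fun n => F n%:R)).
  by move: FNy; rewrite -(cvg_shiftS (fun n => F (- n%:R))).
rewrite /Rintegral.
by rewrite -(cvg_lim _ cv) // (cvg_lim _ cv0).
Unshelve. all: by end_near. Qed.

Variable s : R.
Hypothesis s_gt0 : 0 < s.
Let s_neq0 : s != 0. Proof. by rewrite gt_eqF. Qed.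
Local Notation phi := (normal_pdf 0 s).

Let phiE t : phi t = normal_peak s * expR (- (t ^+ 2 / (s ^+ 2 *+ 2))).
Proof. by rewrite normal_pdfE // /normal_fun subr0 mulNr. Qed.

Global Instance is_derive_normal_pdf (t : R) :
  is_derive t 1 phi (- (s^-2 * t * phi t)).
Proof.
rewrite (_ : phi = fun t => normal_peak s * expR (- (t ^+ 2 / (s ^+ 2 *+ 2)))).
  apply: is_derive_eq; rewrite /GRing.scale /= -mulr_natr; field.
  exact: s_neq0.
by apply/funext => x; rewrite phiE.
Qed.

Let phi_cvg0 : phi n%:R @[n --> \oo] --> (0 : R).
Proof.
pose g n := gauss_fun (n%:R / Num.sqrt (s ^+ 2 *+ 2)).
have g0 : g n @[n --> \oo] --> (0 : R).
  apply: (cvg_comp (GRing.natmul 1) (fun x => gauss_fun (x / Num.sqrt (s ^+ 2 *+ 2))));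
    first exact: cvgr_idn.
  apply: (cvg_comp (fun x => x / Num.sqrt (s ^+ 2 *+ 2)) (@gauss_fun R));
    last exact: cvg_gauss_fun.
  apply: gt0_cvgMly; last exact: cvg_id.
  by rewrite invr_gt0 sqrtr_gt0 mulrn_wgt0 // exprn_gt0.
rewrite (_ : (fun n => phi n%:R) = fun n => normal_peak s * g n).
  have : (normal_peak s * g n) @[n --> \oo] --> normal_peak s * 0 by exact: cvgMl_tmp.
  by rewrite mulr0; apply.
apply/funext => n /=; rewrite phiE /g /gauss_fun expr_div_n sqr_sqrtr //.
by rewrite mulrn_wge0 // sqr_ge0.
Qed.

Let phi_cvg0N : phi (- n%:R) @[n --> \oo] --> (0 : R).
Proof.
suff -> : (fun n => phi (- n%:R)) = fun n => phi n%:R by [].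
by apply/funext => n; rewrite !phiE sqrrN.
Qed.

Let cphi : continuous phi.
Proof. exact: continuous_normal_pdf. Qed.

Let bounded_mul_cvg0 (u v : nat -> R) : u n @[n --> \oo] --> (0 : R) ->
  (forall n, `|v n| <= 1) -> (u n * v n) @[n --> \oo] --> (0 : R).
Proof.
move=> u0 v1; apply: norm_cvg0.
apply: (@squeeze_cvgr _ _ _ _ (cst 0) (fun n => `|u n|)).
- by apply: nearW => n; rewrite normr_ge0 normrM ler_piMr.
- exact: cvg_cst.
- by rewrite -(normr0 R); apply: cvg_norm.
Qed.

Let sin_bd (x : R) : `|sin x| <= 1.
Proof. by rewrite ler_norml sin_geN1 sin_le1. Qed.
Let cos_bd (x : R) : `|cos x| <= 1.
Proof. by rewrite ler_norml cos_geN1 cos_le1. Qed.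

Lemma integrable_normal_pdf_bounded (h : R -> R) : measurable_fun setT h ->
  (forall x, `|h x| <= 1) ->
  mu.-integrable setT (EFin \o (fun x => phi x * h x)).
Proof.
move=> mh h1; apply: (le_integrable _ _ _ (integrable_normal_pdf 0 s)) => //.
  apply/measurable_EFinP; apply: measurable_funM => //.
  exact: measurable_normal_pdf.
move=> x _ /=; rewrite lee_fin normrM ler_piMr //.
Qed.

(* The factor [x] is absorbed by a wider Gaussian. *)
Let G (x : R) : R := 2 * s * (normal_peak s / normal_peak (2 * s)) * normal_pdf 0 (2 * s) x.

Let id_phi_le x : `|x * phi x| <= G x.
Proof.
have s20 : 2 * s != 0 by rewrite mulf_neq0.
have pk : 0 < normal_peak (2 * s) by exact: normal_peak_gt0.
rewrite /G normrM (ger0_norm (normal_pdf_ge0 _ _ _)) phiE normal_pdfE //.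
rewrite /normal_fun subr0.
rewrite [leRHS](_ : _ = normal_peak s *
   (2 * s * expR (- x ^+ 2 / ((2 * s) ^+ 2 *+ 2)))); last first.
  by field; rewrite gt_eqF.
rewrite mulrCA ler_wpM2l ?normal_peak_ge0 //.
rewrite [X in expR X](_ : _ = - (x ^+ 2 / ((2 * s) ^+ 2 *+ 2)) * 4); last first.
  by field.
set y := x ^+ 2 / _.
have y0 : 0 <= y by rewrite divr_ge0 ?sqr_ge0 // mulrn_wge0 // sqr_ge0.
(* With z = |x|/(2s), so that 2y = z^2, this is 2z <= 1 + z^2. One factor exp(-2y) of exp(-4y) then
   absorbs 1 + 2y, and the other one is at most exp(-y). *)
have xs : `|x| <= s * (1 + y *+ 2).
  have -> : y *+ 2 = (`|x| / (2 * s)) ^+ 2.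
    by rewrite expr_div_n real_normK ?num_real // /y; field.
  set z := `|x| / _.
  have -> : `|x| = 2 * s * z by rewrite /z; field.
  rewrite -subr_ge0 (_ : _ - _ = s * (z - 1) ^+ 2); last by ring.
  by rewrite mulr_ge0 ?sqr_ge0 // ltW.
have e4 : expR (- y * 4) = expR (- (y *+ 2)) * expR (- (y * 2)).
  by rewrite -expRD; congr expR; ring.
have ey : (1 + y *+ 2) * expR (- (y *+ 2)) <= 1.
  by rewrite expRN ler_pdivrMr ?expR_gt0 // mul1r expR_ge1Dx.
apply: (@le_trans _ _ (s * (1 + y *+ 2) * expR (- y * 4))).
  by rewrite ler_wpM2r // expR_ge0.
rewrite e4 mulrA -(mulrA s) mulNr -/y (mulrC 2) -!(mulrA s).
rewrite ler_wpM2l ?(ltW s_gt0) //.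
apply: (@le_trans _ _ (1 * expR (- (y * 2)))).
  by rewrite ler_wpM2r // expR_ge0.
rewrite mul1r (@le_trans _ _ (expR (- y))) //.
  by rewrite ler_expR lerN2 ler_peMr // ler1n.
by rewrite ler_peMl ?expR_ge0 // ler1n.
Qed.

Let integrable_G : mu.-integrable setT (EFin \o G).
Proof.
rewrite (_ : EFin \o G = fun x => ((2 * s * (normal_peak s / normal_peak (2 * s)))%:E * (normal_pdf 0 (2 * s) x)%:E)%E) //.
by apply: integrableZl => //; exact: integrable_normal_pdf.
Qed.

Lemma integrable_id_normal_pdf_bounded (h : R -> R) : measurable_fun setT h ->
  (forall x, `|h x| <= 1) ->
  mu.-integrable setT (EFin \o (fun x => x * phi x * h x)).
Proof.
move=> mh h1; apply: (le_integrable _ _ _ integrable_G) => //.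
  apply/measurable_EFinP; apply: measurable_funM => //.
  by apply: measurable_funM => //; exact: measurable_normal_pdf.
move=> x _ /=; rewrite lee_fin.
rewrite (le_trans _ (ler_norm _)) // (le_trans _ (id_phi_le x)) //.
by rewrite normrM ler_piMr.
Qed.

Let cvg_lin (x th : R) : continuous (fun t => x * t + th).
Proof.
move=> t; apply: cvgD; last exact: cvg_cst.
by apply: cvgMl_tmp; exact: cvg_id.
Qed.

Let mcos (x th : R) : measurable_fun setT (fun t => cos (x * t + th)).
Proof.
apply: continuous_measurable_fun => t.
by apply: continuous_comp; [exact: cvg_lin|exact: continuous_cos].
Qed.
Let msin (x th : R) : measurable_fun setT (fun t => sin (x * t + th)).
Proof.
apply: continuous_measurable_fun => t.
by apply: continuous_comp; [exact: cvg_lin|exact: continuous_sin].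
Qed.

(** The derivative of phi(t) sin(x t + th) has integral zero, and phi' = - t phi / s^2. *)
Let ibp (x th : R) :
  \int[mu]_t (t * phi t * sin (x * t + th)) =
  s ^+ 2 * x * \int[mu]_t (phi t * cos (x * t + th)).
Proof.
have i1 := @integrable_id_normal_pdf_bounded _ (msin x th) (fun t => sin_bd _).
have i2 := @integrable_normal_pdf_bounded _ (mcos x th) (fun t => cos_bd _).
pose g1 t := (- s^-2) * (t * phi t * sin (x * t + th)).
pose g2 t := x * (phi t * cos (x * t + th)).
pose g t := g1 t + g2 t.
have j1 : mu.-integrable setT (EFin \o (fun t => (- s^-2) * (t * phi t * sin (x * t + th)))).
  rewrite (_ : _ \o _ = fun t => ((- s^-2)%:E * (t * phi t * sin (x * t + th))%:E)%E) //.
  exact: integrableZl.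
have j2 : mu.-integrable setT (EFin \o (fun t => x * (phi t * cos (x * t + th)))).
  rewrite (_ : _ \o _ = fun t => (x%:E * (phi t * cos (x * t + th))%:E)%E) //.
  exact: integrableZl.
have : \int[mu]_t g t = 0.
  apply: (@Rintegral_derivative_eq0 (fun t => phi t * sin (x * t + th))).
  - move=> t; apply: cvgD; apply: cvgMl_tmp.
      apply: cvgM; first by apply: cvgM; [exact: cvg_id|exact: cphi].
      by apply: continuous_comp; [exact: cvg_lin|exact: continuous_sin].
    apply: cvgM; first exact: cphi.
    by apply: continuous_comp; [exact: cvg_lin|exact: continuous_cos].
  - rewrite (_ : EFin \o g = (EFin \o g1) \+ (EFin \o g2))%E //.
    exact: integrableD.
  - move=> t; apply: is_derive_eq; rewrite /g /g1 /g2 /GRing.scale /=; ring.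
  - by apply: bounded_mul_cvg0.
  - by apply: bounded_mul_cvg0.
rewrite RintegralD // !RintegralZl //.
set a := Rintegral _ _ _; set b := Rintegral _ _ _ => /eqP.
rewrite mulNr addrC subr_eq0 => /eqP xb.
by rewrite -mulrA xb mulVKf // expf_neq0.
Qed.

(** As a function of x the integral F satisfies F' = - s^2 x F: differentiation under the integral
    brings down - t sin, which [ibp] turns back into F. Hence F(x) exp(s^2 x^2 / 2) is constant. The
    phase [th] covers the sine transform as well, at th = - pi/2. *)
Lemma Rintegral_normal_pdf_cos (x th : R) :
  \int[mu]_t (phi t * cos (x * t + th)) =
  cos th * expR (- (s ^+ 2 * x ^+ 2 / 2)).
Proof.
pose F x := \int[mu]_t (phi t * cos (x * t + th)).
have dF (y : R) : is_derive y 1 F (- (s ^+ 2 * y * F y)).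
  pose f y t := phi t * cos (y * t + th).
  have df (z t : R) : is_derive z 1 (f^~ t) (- (t * phi t * sin (z * t + th))).
    by apply: is_derive_eq; rewrite /GRing.scale /=; ring.
  have p1 z t : partial1of2 f z t = - (t * phi t * sin (z * t + th)).
    by rewrite partial1of2E; apply: derive_val.
  have Iy : `]y - 1, y + 1[%classic y.
    by rewrite /= in_itv /= ltrBlDr ltrDl ltr01.
  have intf z : `]y - 1, y + 1[%classic z -> mu.-integrable setT (EFin \o f z).
    by move=> _; apply: integrable_normal_pdf_bounded.
  have derf z t : `]y - 1, y + 1[%classic z -> setT t -> derivable (f^~ t) z 1.
    by move=> _ _; have [] := df z t.
  have G0 t : 0 <= G t by rewrite (le_trans _ (id_phi_le t)).
  have Gub z t : `]y - 1, y + 1[%classic z -> setT t -> `|partial1of2 f z t| <= G t.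
    move=> _ _; rewrite p1 normrN (le_trans _ (id_phi_le t)) //.
    by rewrite normrM ler_piMr.
  have D := derivable_under_integral measurableT Iy intf derf G0 integrable_G Gub.
  have E := differentiation_under_integral measurableT Iy intf derf G0 integrable_G Gub.
  apply: DeriveDef; first exact: D.
  rewrite -derive1E [LHS]E.
  rewrite -ibp -mulN1r -RintegralZl //.
    by apply: eq_Rintegral => t _; rewrite p1 mulN1r.
  exact: integrable_id_normal_pdf_bounded.
have d0 (y : R) : is_derive y 1 (fun y => F y * expR (s ^+ 2 * y ^+ 2 / 2)) 0.
  by apply: is_derive_eq; rewrite /GRing.scale /=; field.
have := is_derive_0_is_cst x 0 d0.
rewrite expr0n /= mulr0 mul0r expR0 mulr1.
have -> : F 0 = cos th.
  rewrite /F.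
  under eq_Rintegral do rewrite mul0r add0r mulrC.
  rewrite RintegralZl //; last exact: integrable_normal_pdf.
  by rewrite /Rintegral integral_normal_pdf /= mulr1.
by rewrite expRN => <-; rewrite mulfK // gt_eqF // expR_gt0.
Qed.

End GaussFourier.

(** * Integration lemmas *)

Section RealAnalysis.
Context {R : realType}.
Local Notation mu := (@lebesgue_measure R).

Lemma is_derive_bigsum (I : Type) (r : seq I) (f : I -> R -> R) (df : I -> R)
    (x : R) : (forall i, is_derive x 1 (f i) (df i)) ->
  is_derive x 1 (fun y => \sum_(i <- r) f i y) (\sum_(i <- r) df i).
Proof.
move=> dfi; elim: r => [|i r IH].
  under eq_fun do rewrite big_nil.
  by rewrite big_nil; apply: is_derive_cst.
under eq_fun do rewrite big_cons.
by rewrite big_cons; apply: is_deriveD.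
Qed.

Lemma continuous_bigsum (T : topologicalType) (I : Type) (r : seq I)
    (f : I -> T -> R) (x : T) : (forall i, {for x, continuous (f i)}) ->
  {for x, continuous (fun y => \sum_(i <- r) f i y)}.
Proof.
move=> cf; elim: r => [|i r IH].
  rewrite (_ : (fun y => _) = cst 0); first exact: cvg_cst.
  by apply/funext => y; rewrite big_nil.
rewrite (_ : (fun y => _) = fun y => f i y + \sum_(i <- r) f i y).
  by apply: cvgD; [exact: cf|exact: IH].
by apply/funext => y; rewrite big_cons.
Qed.

Lemma ge0_integral_shift (f : R -> R) (a : R) :
  continuous f -> (forall x, 0 <= f x) ->
  (\int[mu]_x (f (x + a))%:E = \int[mu]_x (f x)%:E)%E.
Proof.
move=> cf f0.
have dF (x : R) : is_derive x 1 (fun x : R => x + a) 1.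
  by apply: is_derive_eq; rewrite addr0.
have F1 : derive1 (fun x : R => x + a) = cst 1.
  by apply/funext => x; rewrite derive1E; apply: derive_val.
rewrite [RHS](@increasing_ge0_integration_by_substitutionT _ (fun x => x + a)) //.
- apply: eq_integral => x _ /=; rewrite F1 /= mulr1 //.
- by move=> x y xy; rewrite ltrD2r.
- by rewrite F1; exact: cst_continuous.
- by rewrite F1; apply: is_cvg_cst.
- by rewrite F1; apply: is_cvg_cst.
- apply/cvgrNyPle => A; near=> x; rewrite -lerBrDr; near: x.
  by apply: nbhs_ninfty_le; exact: num_real.
- apply/cvgryPge => A; near=> x; rewrite -lerBlDr; near: x.
  by apply: nbhs_pinfty_ge; exact: num_real.
Unshelve. all: by end_near. Qed.

(** Tonelli's theorem is applied on the whole plane to f times the indicator of D, since f is known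
    to be nonnegative only for s in D. *)
Lemma ge0_tonelli_itv (D : set R) (f : R * R -> R) : measurable D ->
  measurable_fun setT f -> (forall x s, D s -> 0 <= f (x, s)) ->
  (\int[mu]_x \int[mu]_(s in D) (f (x, s))%:E =
   \int[mu]_(s in D) \int[mu]_x (f (x, s))%:E)%E.
Proof.
move=> mD mf f0.
pose h (z : R * R) := (f z * \1_D z.2)%:E.
have h0 z : (0 <= h z)%E.
  case: z => x s; rewrite lee_fin /= indicE.
  by have [/set_mem/(f0 x)|] := boolP (s \in D); rewrite ?mulr1 ?mulr0.
have mh : measurable_fun setT h.
  apply/measurable_EFinP; apply: measurable_funM => //.
  apply: measurableT_comp; last exact: measurable_snd.
  exact: measurable_indic.
have hD x s : h (x, s) = ((fun s => (f (x, s))%:E) \_ D) s.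
  by rewrite patchE /h indicE; case: ifP => _; rewrite ?mulr1 ?mulr0.
transitivity (\int[mu]_x \int[mu]_s h (x, s))%E.
  apply: eq_integral => x _; rewrite integral_mkcond.
  by apply: eq_integral => s _; rewrite hD.
transitivity (\int[mu]_s \int[mu]_x h (x, s))%E; first exact: fubini_tonelli.
rewrite [RHS]integral_mkcond.
apply: eq_integral => s _; rewrite patchE; case: ifPn => sD.
  by apply: eq_integral => x _; rewrite hD patchE sD.
by apply: integral0_eq => x _; rewrite hD patchE (negbTE sD).
Qed.

Lemma measurable_fun_integral_itv d (T : measurableType d) (D : set R)
    (f : T * R -> R) : measurable D -> measurable_fun setT f ->
  (forall x s, D s -> 0 <= f (x, s)) ->
  measurable_fun setT (fun x => \int[mu]_(s in D) (f (x, s))%:E)%E.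
Proof.
move=> mD mf f0.
pose h (z : T * R) := (f z * \1_D z.2)%:E.
have h0 z : (0 <= h z)%E.
  case: z => x s; rewrite lee_fin /= indicE.
  by have [/set_mem/(f0 x)|] := boolP (s \in D); rewrite ?mulr1 ?mulr0.
have mh : measurable_fun setT h.
  apply/measurable_EFinP; apply: measurable_funM => //.
  apply: measurableT_comp; last exact: measurable_snd.
  exact: measurable_indic.
rewrite (_ : (fun x => _) = fubini_F mu h).
  exact: measurable_fun_fubini_tonelli_F.
apply/funext => x; rewrite integral_mkcond; apply: eq_integral => s _.
by rewrite patchE /h indicE /=; case: ifP => _; rewrite ?mulr1 ?mulr0.
Qed.

(** Inversion is not continuous at 0, but on nonnegative reals, 0 included, it agrees with the
    measurable power of exponent -1. *)
Lemma measurable_funV_ge0 d (T : measurableType d) (f : T -> R) :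
  measurable_fun setT f -> (forall x, 0 <= f x) ->
  measurable_fun setT (fun x => (f x)^-1).
Proof.
move=> mf f0.
rewrite (_ : (fun x => _) = (@powR R)^~ (-1) \o f).
  apply: measurableT_comp => //; exact: measurable_powR.
by apply/funext => x /=; rewrite powR_inv1.
Qed.

(** Completing the square at the midpoint m leaves a normal density of standard deviation kappa
    times exp(-(nu - nu')^2 / (8 kappa^2)), and this factor is the characteristic function of N(0,
    (2 kappa)^-2) at nu - nu'. Integrals over frequency thereby become averages over time. *)
Lemma integral_gaussian_overlap (kappa nu nu' : R) : 0 < kappa ->
  let G x := Num.sqrt (normal_peak kappa) * expR (- (x ^+ 2 / (4 * kappa ^+ 2))) in
  mu.-integrable setT (EFin \o (fun w => G (w - nu) * G (w - nu'))) /\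
  \int[mu]_w (G (w - nu) * G (w - nu')) =
  \int[mu]_t (normal_pdf 0 (2 * kappa)^-1 t * cos ((nu - nu') * t)).
Proof.
move=> k0 G; have kn0 : kappa != 0 by rewrite gt_eqF.
pose m := (nu + nu') / 2.
pose e := expR (- ((nu - nu') ^+ 2 / (8 * kappa ^+ 2))).
have GG w : G (w - nu) * G (w - nu') = e * normal_pdf m kappa w.
  rewrite /G mulrACA -expr2 sqr_sqrtr ?normal_peak_ge0 // -expRD.
  rewrite normal_pdfE // /normal_fun [RHS]mulrCA /e -expRD; congr (_ * expR _).
  by rewrite /m; field.
have ipdf : mu.-integrable setT (EFin \o normal_pdf m kappa).
  exact: integrable_normal_pdf.
split.
  rewrite (_ : _ \o _ = fun w => (e%:E * (normal_pdf m kappa w)%:E)%E).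
    exact: integrableZl.
  by apply/funext => w /=; rewrite GG.
under eq_Rintegral do rewrite GG.
rewrite RintegralZl //.
have -> : \int[mu]_w normal_pdf m kappa w = 1.
  by rewrite /Rintegral integral_normal_pdf.
have s0 : 0 < (2 * kappa)^-1 by rewrite invr_gt0 mulr_gt0.
have := Rintegral_normal_pdf_cos s0 (nu - nu') 0.
under eq_Rintegral do rewrite addr0.
by rewrite cos0 mul1r mulr1 /e => ->; congr expR; field.
Qed.

Let D := `[(- 2^-1 : R), (2^-1 : R)]%classic.

(** For s >= 0, sin x >= x/2 at x = pi/2 - pi s together with pi >= 2 gives 4 cos(pi s) >= 2 (1 -
    2s), and 2 >= 1 + 2s. *)
Lemma cos_pi_ge (s : R) : D s -> 1 - 4 * s ^+ 2 <= 4 * cos (pi * s).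
Proof.
wlog s0 : s / 0 <= s.
  move=> W; have [/W //|s0] := leP 0 s.
  rewrite /D /= in_itv /= => /andP[h1 h2].
  rewrite -sqrrN -(opprK s) mulrN cosN opprK; apply: W; first by rewrite oppr_ge0 ltW.
  by rewrite /D /= in_itv /= lerN2 h2 lerNl h1.
rewrite /D /= in_itv /= => /andP[_ s1].
have pi2 : (2 : R) <= pi by exact: pi_ge2.
have sinle (x : R) : 0 <= x <= pi / 2 -> x / 2 <= sin x.
  move=> /andP[x0 x1].
  have [->|xn0] := eqVneq x 0; first by rewrite mul0r sin0.
  have xp : 0 < x / 2 by rewrite divr_gt0 // lt_def xn0.
  have ds (y : R) : is_derive y 1 (@sin R) (cos y) by exact: is_derive_sin.
  have cs : {within `[0, x / 2], continuous (@sin R)}.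
    by apply: continuous_subspaceT; exact: continuous_sin.
  have [c] := MVT xp (fun y _ => ds y) cs.
  rewrite in_itv /= => /andP[c0 cx]; rewrite sin0 !subr0 => sE.
  have c2 (y : R) : 0 <= y <= x / 2 -> 2^-1 <= cos y ^+ 2.
    move=> /andP[y0 yx].
    have : 0 <= cos (y *+ 2) by apply: cos_ge0_pihalf; lra.
    by rewrite cos_mulr2n => ?; lra.
  have c0' (y : R) : 0 <= y <= x / 2 -> 0 <= cos y.
    by move=> /andP[y0 yx]; apply: cos_ge0_pihalf; lra.
  (* Now sin x = 2 sin(x/2) cos(x/2) = x cos c cos(x/2); both angles are at most pi/4, so each
     cosine has square at least 1/2. *)
  have cc : 2^-1 <= cos (x / 2) * cos c.
    rewrite -(@ler_pXn2r _ 2) ?nnegrE ?mulr_ge0 ?c0' ?invr_ge0 //; try lra.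
    have h1 : 2^-1 <= cos (x / 2) ^+ 2 by apply: c2; lra.
    have h2 : 2^-1 <= cos c ^+ 2 by apply: c2; lra.
    by rewrite exprMn expr2; apply: ler_pM.
  have -> : x = x / 2 *+ 2 by rewrite -mulr_natr; field.
  rewrite sin_mulr2n sE -mulr_natr.
  rewrite -subr_ge0 (_ : _ - _ = x * (cos (x / 2) * cos c - 2^-1)); last by field.
  by rewrite mulr_ge0 // subr_ge0.
have : (pi / 2 - pi * s) / 2 <= sin (pi / 2 - pi * s).
  apply: sinle; rewrite subr_ge0 lerBlDr lerDl mulr_ge0 ?pi_ge0 // andbT.
  by rewrite ler_pM2l ?pi_gt0.
rewrite sinB sin_pihalf cos_pihalf mul0r subr0 mul1r.
nra.
Qed.
End RealAnalysis.

(** * Weighted fundamental theorem and the kernel g_s *)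

Section Weighted.
Context {R : realType}.
Local Notation mu := (@lebesgue_measure R).
Local Notation D := `[(- 2^-1 : R), (2^-1 : R)]%classic.

Lemma continuous_FTC2_cc (F f : R -> R) (a b : R) : a < b ->
  (forall x, a <= x <= b -> is_derive x 1 F (f x)) ->
  (forall x, a <= x <= b -> {for x, continuous f}) ->
  (\int[mu]_(x in `[a, b]) (f x)%:E = (F b - F a)%:E)%E.
Proof.
move=> ab dF cf.
have cF x : a <= x <= b -> {for x, continuous F}.
  move=> /dF[dFx _]; exact/differentiable_continuous/derivable1_diffP.
rewrite EFinB; apply: continuous_FTC2 => //.
- apply: continuous_in_subspaceT => x.
  by rewrite inE /= in_itv /=; exact: cf.
- split.
  + by move=> x; rewrite in_itv /= => /andP[/ltW ax /ltW xb];
      have [] := dF x; rewrite ?ax ?xb.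
  + by apply: cvg_at_right_filter; apply: cF; rewrite lexx ltW.
  + by apply: cvg_at_left_filter; apply: cF; rewrite lexx ltW.
- move=> x; rewrite in_itv /= => /andP[/ltW ax /ltW xb].
  by rewrite derive1E; apply: derive_val; apply: dF; rewrite ax xb.
Qed.

(** Factors as (1 + d + 2s)(1 + d - 2s): the inverse has two simple poles, at distance d/2 from D,
    and is integrated by partial fractions. *)
Definition weight (d s : R) : R := (1 + d) ^+ 2 - 4 * s ^+ 2.

(* [\int_D (weight d s)^-1 ds] *)
Definition weight_mass (d : R) : R := ln ((2 + d) / d) / (2 * (1 + d)).

Lemma weight_gt0 (d s : R) : 0 < d -> D s -> 0 < weight d s.
Proof. rewrite /D /weight /= in_itv /= => d0 /andP[h1 h2]; nra. Qed.

Lemma weight_mass_gt0 (d : R) : 0 < d -> 0 < weight_mass d.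
Proof.
move=> d0; rewrite divr_gt0 //; last by rewrite mulr_gt0 // ltr_wpDl.
rewrite ln_gt0 // ltr_pdivlMr // mul1r ltrDr //.
Qed.

(** Cauchy-Schwarz in integrated form, for all k at once. The function [f] below has an explicit
    antiderivative with increment De/2 over D, and l/2 times the integrand on the right exceeds [f]
    by a sum of squares of Dl k - l weight(s) u' k s with nonnegative coefficients. *)
Lemma weighted_FTC (K : finType) (q : K -> R) (u u' : K -> R -> R) (d : R) :
  0 < d -> (forall k, 0 <= q k) ->
  (forall k (x : R), is_derive x 1 (u k) (u' k x)) ->
  (forall k, continuous (u' k)) ->
  ((\sum_k q k * (u k 2^-1 - u k (- 2^-1)) ^+ 2)%:E <=
   (weight_mass d)%:E *
     \int[mu]_(s in D) (weight d s * \sum_k q k * u' k s ^+ 2)%:E)%E.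
Proof.
move=> d0 q0 du cu'.
pose Dl k := u k 2^-1 - u k (- 2^-1).
pose De := \sum_k q k * Dl k ^+ 2.
pose b := 1 + d; pose l := weight_mass d.
have b0 : 0 < b by rewrite ltr_wpDl.
have l0 : 0 < l by exact: weight_mass_gt0.
pose L s := (ln (b + 2 * s) - ln (b - 2 * s)) / (4 * b).
have dL (s : R) : - 2^-1 <= s <= 2^-1 -> is_derive s 1 L (weight d s)^-1.
  move=> sD; have w0 : 0 < weight d s by apply: weight_gt0; rewrite /= ?in_itv.
  case/andP: sD => h1 h2.
  have p1 : 0 < b + 2 * s by rewrite /b; lra.
  have p2 : 0 < b - 2 * s by rewrite /b; lra.
  have i1 := is_derive1_ln p1; have i2 := is_derive1_ln p2.
  have e1 : is_derive s 1 (fun s => b + 2 * s) 2.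
    by apply: is_derive_eq; rewrite /GRing.scale /=; ring.
  have e2 : is_derive s 1 (fun s => b - 2 * s) (-2).
    by apply: is_derive_eq; rewrite /GRing.scale /=; ring.
  have j1 := @is_derive1_comp _ (@ln R) (fun s => b + 2 * s) s _ _ i1 e1.
  have j2 := @is_derive1_comp _ (@ln R) (fun s => b - 2 * s) s _ _ i2 e2.
  have j := is_deriveM (is_deriveB j1 j2) (is_derive_cst (4 * b)^-1 s 1).
  apply: (@is_derive_eq _ _ _ _ _ _ _ _ j); rewrite /GRing.scale /=.
  have wE : weight d s = (b + 2 * s) * (b - 2 * s) by rewrite /weight /b; ring.
  by rewrite wE; field; rewrite !gt_eqF.
have LE : L 2^-1 - L (- 2^-1) = l.
  have L1 : L 2^-1 = (ln (2 + d) - ln d) / (4 * b).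
    rewrite /L (_ : b + 2 / 2 = 2 + d); last by rewrite /b; field.
    by rewrite (_ : b - 2 / 2 = d) //; rewrite /b; field.
  have L2 : L (- 2^-1) = (ln d - ln (2 + d)) / (4 * b).
    rewrite /L (_ : b + 2 * - 2^-1 = d); last by rewrite /b; field.
    by rewrite (_ : b - 2 * - 2^-1 = 2 + d) //; rewrite /b; field.
  rewrite L1 L2 /l /weight_mass ln_div ?posrE ?addr_gt0 // -/b.
  by field; rewrite gt_eqF.
pose f s := \sum_k q k * Dl k * u' k s - De / (2 * l) * (weight d s)^-1.
pose F s := \sum_k q k * Dl k * u k s - De / (2 * l) * L s.
have cw (s : R) : {for s, continuous (weight d)}.
  apply: cvgB; first exact: cvg_cst.
  by apply: cvgMl_tmp; exact: exprn_continuous.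
have dF (s : R) : - 2^-1 <= s <= 2^-1 -> is_derive s 1 F (f s).
  move=> sD; apply: is_deriveB.
    by apply: is_derive_bigsum => k; apply: is_deriveZ.
  have := dL s sD; exact: is_deriveZ.
have cf (s : R) : - 2^-1 <= s <= 2^-1 -> {for s, continuous f}.
  move=> sD; apply: cvgB.
    by apply: continuous_bigsum => k; apply: cvgMl_tmp; exact: cu'.
  apply: cvgMl_tmp; apply: cvgV; last exact: cw.
  by rewrite gt_eqF // weight_gt0 //= in_itv.
have ab : (- 2^-1 : R) < 2^-1 by lra.
have := continuous_FTC2_cc ab dF cf.
have -> : F 2^-1 - F (- 2^-1) = De / 2.
  rewrite /F [LHS](_ : _ = (\sum_k q k * Dl k * u k 2^-1 - \sum_k q k * Dl k * u k (- 2^-1))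
     - De / (2 * l) * (L 2^-1 - L (- 2^-1))); last by ring.
  rewrite LE -sumrB (_ : \sum_k _ = De); first by field; rewrite gt_eqF.
  by apply: eq_bigr => k _; rewrite /Dl; ring.
pose W s := weight d s * \sum_k q k * u' k s ^+ 2.
have cW : continuous W.
  move=> s; apply: cvgM; first exact: cw.
  apply: continuous_bigsum => k; apply: cvgMl_tmp.
  by apply: (@continuous_comp _ _ _ (u' k) (fun x => x ^+ 2));
    [exact: cu'|exact: exprn_continuous].
have iW : mu.-integrable D (EFin \o W).
  apply: continuous_compact_integrable; first exact: segment_compact.
  exact: continuous_subspaceT.
have if_ : mu.-integrable D (EFin \o f).
  apply: continuous_compact_integrable; first exact: segment_compact.
  by apply: continuous_in_subspaceT => s; rewrite inE /= in_itv /=; exact: cf.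
have i2 : mu.-integrable D (EFin \o (fun s => l / 2 * W s)).
  rewrite (_ : _ \o _ = fun s => ((l / 2)%:E * (W s)%:E)%E) //.
  exact: integrableZl.
have le_fW : (\int[mu]_(s in D) (f s)%:E <= \int[mu]_(s in D) (l / 2 * W s)%:E)%E.
  apply: le_integral => // s /set_mem sD; rewrite lee_fin.
  have w0 := weight_gt0 d0 sD.
  rewrite -subr_ge0 /f /W.
  have -> : l / 2 * (weight d s * (\sum_k q k * u' k s ^+ 2)) -
    (\sum_k q k * Dl k * u' k s - De / (2 * l) * (weight d s)^-1) =
    \sum_k q k / (2 * l * weight d s) * (Dl k - l * weight d s * u' k s) ^+ 2.
    rewrite mulrA mulr_sumr opprB addrA addrAC /De !mulr_suml -!sumrB -big_split /=.
    apply: eq_bigr => k _; field.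
    by rewrite !gt_eqF.
  apply: sumr_ge0 => k _; rewrite mulr_ge0 ?sqr_ge0 // divr_ge0 //.
  exact: (ltW (mulr_gt0 (mulr_gt0 (ltr0Sn R 1) l0) w0)).
move=> E; rewrite E in le_fW.
move: le_fW; under eq_integral do rewrite EFinM; rewrite integralZl //.
rewrite -/W -/l -/De.
rewrite -[X in ((l / 2)%:E * X)%E](fineK (integrable_fin_num _ iW)) //.
rewrite -[X in (l%:E * X)%E](fineK (integrable_fin_num _ iW)) //.
rewrite -!EFinM !lee_fin => h; lra.
Qed.

End Weighted.

Section CoshKernel.
Context {R : realType}.
Local Notation mu := (@lebesgue_measure R).
Local Notation D := `[(- 2^-1 : R), (2^-1 : R)]%classic.
Variable beta : R.
Hypothesis beta_gt0 : 0 < beta.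
Local Notation cosh := (@cosh R).
Let beta_neq0 : beta != 0. Proof. by rewrite gt_eqF. Qed.

Lemma cosh_ge1 (x : R) : 1 <= cosh x.
Proof.
rewrite /Defs.cosh ler_pdivlMr // mul1r expRN.
have e0 := expR_gt0 x; rewrite -subr_ge0.
rewrite (_ : _ - _ = (expR x - 1) ^+ 2 / expR x); last by field; rewrite gt_eqF.
by rewrite divr_ge0 ?sqr_ge0 // ltW.
Qed.

Lemma cosh_gt0 (x : R) : 0 < cosh x.
Proof. exact: lt_le_trans (cosh_ge1 x). Qed.

Let sinh (x : R) : R := (expR x - expR (- x)) / 2.

Let cosh2 (x : R) : cosh x ^+ 2 = 1 + sinh x ^+ 2.
Proof.
have e0 := expR_gt0 x.
by rewrite /Defs.cosh /sinh expRN; field; rewrite gt_eqF.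
Qed.

Let cosh_double (x : R) : cosh (2 * x) = 2 * cosh x ^+ 2 - 1.
Proof.
have e0 := expR_gt0 x.
rewrite /Defs.cosh (_ : 2 * x = x + x) ?opprD ?expRD ?expRN; last by ring.
by field; rewrite gt_eqF.
Qed.

Lemma cos_pi_ge0 (s : R) : D s -> 0 <= cos (s * pi).
Proof.
rewrite /= in_itv /= => /andP[h1 h2]; have p := pi_gt0 R.
by apply: cos_ge0_pihalf; nra.
Qed.

(** Uses cosh 2x + cos 2y = 2 (sinh^2 x + cos^2 y) at y = s pi. In this form the sign is visible,
    and so is the derivative of an arctangent of sinh x / cos y. *)
Lemma gs_wE (s t : R) : let x := 2 * pi * t / beta in
  gs_w beta s t = beta^-1 *
    (cos (s * pi) * cosh x / (sinh x ^+ 2 + cos (s * pi) ^+ 2)).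
Proof.
move=> x; rewrite /gs_w -/x.
rewrite (_ : 4 * pi * t / beta = 2 * x); last by rewrite /x; ring.
rewrite (_ : 2 * s * pi = (s * pi) *+ 2); last by ring.
have -> : cosh (2 * x) + cos (s * pi *+ 2) =
    2 * (sinh x ^+ 2 + cos (s * pi) ^+ 2).
  by rewrite cosh_double cos_mulr2n cosh2; ring.
rewrite invfM; set u := (sinh x ^+ 2 + _)^-1; move: u (cosh x) => u v; field.
exact: beta_neq0.
Qed.

Lemma g_w_gt0 (t : R) : 0 < g_w beta t.
Proof. by rewrite invr_gt0 mulr_gt0 ?cosh_gt0. Qed.

Lemma gs_w_ge0 (s t : R) : D s -> 0 <= gs_w beta s t.
Proof.
move=> /cos_pi_ge0 c0; rewrite gs_wE mulr_ge0 ?invr_ge0 ?(ltW beta_gt0) //.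
by rewrite divr_ge0 ?mulr_ge0 ?(ltW (cosh_gt0 _)) ?addr_ge0 ?sqr_ge0.
Qed.

Lemma gs_w0 (t : R) : gs_w beta 0 t = g_w beta t.
Proof.
rewrite gs_wE mul0r cos0 mul1r expr1n addrC -cosh2 /g_w.
have := cosh_gt0 (2 * pi * t / beta); move: (cosh _) => c c0.
by field; rewrite !gt_eqF.
Qed.

(** With c = cos(s pi), the gap is c / (beta cosh x) times (1 - c^2) / (sinh^2 x + c^2). *)
Lemma gs_w_ge (s t : R) : D s -> cos (s * pi) * g_w beta t <= gs_w beta s t.
Proof.
move=> sD; have c0 := cos_pi_ge0 sD; rewrite gs_wE /g_w.
set x := _ / beta; have ch := cosh_gt0 x.
have [cz|cn0] := eqVneq (cos (s * pi)) 0; first by rewrite cz !mul0r mulr0.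
have cp : 0 < cos (s * pi) by rewrite lt_def cn0.
have dp : 0 < sinh x ^+ 2 + cos (s * pi) ^+ 2.
  by rewrite ltr_wpDl ?sqr_ge0 // exprn_gt0.
have c1 : cos (s * pi) ^+ 2 <= 1 by rewrite expr_le1 // cos_le1.
rewrite -subr_ge0 [X in 0 <= X](_ : _ = cos (s * pi) / beta / cosh x *
   ((1 - cos (s * pi) ^+ 2) / (sinh x ^+ 2 + cos (s * pi) ^+ 2))).
  by rewrite mulr_ge0 // divr_ge0 ?subr_ge0 ?divr_ge0 // ltW.
have -> : 1 = cosh x ^+ 2 - sinh x ^+ 2 by rewrite cosh2; ring.
field; by rewrite !gt_eqF.
Qed.

(** The antiderivative atan(sinh x / cos(s pi)) / (2 pi) runs from 0 to 1/4 on the half-line, and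
    the kernel is even. It is an inequality because at s = 1/2 and s = -1/2 the cosine vanishes and
    the kernel is identically 0, its quotient 0/0 at t = 0 being 0 by convention. *)
Lemma integral_gs_w (s : R) : D s -> (\int[mu]_t (gs_w beta s t)%:E <= (2^-1)%:E)%E.
Proof.
move=> sD; have c0 := cos_pi_ge0 sD.
have [cz|cn0] := eqVneq (cos (s * pi)) 0.
  under eq_integral do rewrite gs_wE cz !mul0r mulr0.
  by rewrite integral0 lee_fin invr_ge0.
have cp : 0 < cos (s * pi) by rewrite lt_def cn0.
have pp := pi_gt0 R.
have dp (x : R) : 0 < sinh x ^+ 2 + cos (s * pi) ^+ 2.
  by rewrite ltr_wpDl ?sqr_ge0 // exprn_gt0.
pose F t := atan (sinh (2 * pi * t / beta) / cos (s * pi)) / (2 * pi).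
have dF (t : R) : is_derive t 1 F (gs_w beta s t).
  rewrite gs_wE.
  have i1 : is_derive t 1 (fun t => sinh (2 * pi * t / beta) / cos (s * pi))
      (cosh (2 * pi * t / beta) * (2 * pi / beta) / cos (s * pi)).
    apply: is_derive_eq; rewrite /GRing.scale /= /Defs.cosh; field.
    by rewrite cn0 beta_neq0.
  have i2 := @is_derive1_comp _ (@atan R) (fun t => sinh (2 * pi * t / beta) / cos (s * pi)) t _ _ (is_derive1_atan _) i1.
  have j := is_deriveM i2 (is_derive_cst (2 * pi)^-1 t 1).
  apply: (@is_derive_eq _ _ _ _ _ _ _ _ j); rewrite /GRing.scale /=.
  move: (dp (2 * pi * t / beta)) cn0.
  move: (sinh _) (cosh _) (cos _) => S C c.
  move: (pi) pp => P pp dp' cn0.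
  have S1 : 1 + (S / c) ^+ 2 = (S ^+ 2 + c ^+ 2) / c ^+ 2 by field.
  rewrite S1; field.
  by rewrite cn0 beta_neq0 !gt_eqF.
have csinh : continuous sinh.
  move=> x; apply: cvgMr_tmp; apply: cvgB; first exact: continuous_expR.
  apply: continuous_comp; first exact: opp_continuous.
  exact: continuous_expR.
have ccosh : continuous cosh.
  move=> x; apply: cvgMr_tmp; apply: cvgD; first exact: continuous_expR.
  apply: continuous_comp; first exact: opp_continuous.
  exact: continuous_expR.
have clin (t : R) : {for t, continuous (fun t : R => 2 * pi * t / beta)}.
  by apply: cvgMr_tmp; apply: cvgMl_tmp; exact: cvg_id.
have cg : continuous (gs_w beta s).
  rewrite (_ : gs_w beta s = fun t => beta^-1 *
    (cos (s * pi) * (cosh \o (fun t => 2 * pi * t / beta)) t / ((sinh \o (fun t => 2 * pi * t / beta)) t ^+ 2 + cos (s * pi) ^+ 2))); last first.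
    by apply/funext => t; rewrite gs_wE.
  move=> t; apply: cvgMl_tmp; apply: cvgM.
    by apply: cvgMl_tmp; apply: continuous_comp; [exact: clin|exact: ccosh].
  apply: cvgV; first by rewrite gt_eqF //; exact: dp.
  apply: cvgD; last exact: cvg_cst.
  apply: (@continuous_comp _ _ _ (sinh \o _) (fun x => x ^+ 2)); last exact: exprn_continuous.
  by apply: continuous_comp; [exact: clin|exact: csinh].
have ev : gs_w beta s =1 gs_w beta s \o -%R.
  move=> t; rewrite /= /gs_w.
  have coshN x : cosh (- x) = cosh x by rewrite /Defs.cosh opprK addrC.
  by rewrite 2!mulrN 2!mulNr !coshN.
have F0 : F 0 = 0.
  by rewrite /F mulr0 mul0r /sinh oppr0 subrr !mul0r atan0 mul0r.
have Fy : F t @[t --> +oo] --> (4^-1 : R).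
  have quarter (P : R) : 0 < P -> 4^-1 = P / 2 / (2 * P).
    by move=> P0; field; rewrite gt_eqF.
  rewrite (quarter _ pp).
  apply: cvgMr_tmp.
  apply: (cvg_comp (fun t => sinh (2 * pi * t / beta) / cos (s * pi)) (@atan R));
    last exact: cvgy_atan.
  apply: gt0_cvgMly; first by rewrite invr_gt0.
  apply/cvgryPge => A; near=> t.
  have t0 : 0 <= t by near: t; apply: nbhs_pinfty_ge; exact: num_real.
  (* A linear lower bound: with x = 2 pi t / beta, exp(x) >= 1 + x and exp(-x) <= 1 give sinh x >=
     x/2. *)
  apply: (@le_trans _ _ (pi * t / beta)).
    rewrite mulrAC -ler_pdivrMl ?divr_gt0 //; near: t.
  rewrite /sinh; set x := 2 * pi * t / beta.
  have x0 : 0 <= x by rewrite divr_ge0 ?mulr_ge0 // ltW.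
  have -> : pi * t / beta = x / 2 by rewrite /x; field.
  rewrite ler_pM2r ?invr_gt0 //.
  have h1 := expR_ge1Dx x.
  have h2 : expR (- x) <= 1 by rewrite -expR0 ler_expR oppr_le0.
  lra.
rewrite ge0_symfun_integralT //; last by move=> t; exact: gs_w_ge0.
rewrite (_ : [set x | _] = `[0, +oo[%classic); last first.
  by apply/seteqP; split => x /=; rewrite in_itv /= andbT.
rewrite (@ge0_continuous_FTC2y R (gs_w beta s) F 0 4^-1) //.
- by rewrite F0 sube0 -EFinM lee_fin; lra.
- by move=> x _; exact: gs_w_ge0.
- exact: continuous_subspaceT.
- by apply: cvg_at_right_filter; apply/differentiable_continuous/derivable1_diffP; have [] := dF 0.
- by move=> x _; rewrite derive1E; apply: derive_val.
Unshelve. all: by end_near. Qed.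

End CoshKernel.

(** * Gaussian quadratic forms *)

Section Quad.
Context {R : realType}.
Local Notation mu := (@lebesgue_measure R).

Lemma integrable_lincomb (I : Type) (r : seq I) (co : I -> R) (f : I -> R -> R) :
  (forall i, mu.-integrable setT (EFin \o f i)) ->
  mu.-integrable setT (EFin \o (fun x => \sum_(i <- r) co i * f i x)) /\
  \int[mu]_x (\sum_(i <- r) co i * f i x) = \sum_(i <- r) co i * \int[mu]_x f i x.
Proof.
move=> intf.
have intcf i : mu.-integrable setT (EFin \o (fun x => co i * f i x)).
  rewrite (_ : _ \o _ = fun x => ((co i)%:E * (f i x)%:E)%E) //.
  by apply: integrableZl => //; exact: intf.
elim: r => [|i r [IH1 IH2]].
  rewrite (_ : (fun x => _) = cst 0); last by apply/funext => x; rewrite big_nil.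
  split; last by rewrite big_nil Rintegral_cst // mul0r.
  exact: integrable0.
rewrite (_ : (fun x => _) = fun x => co i * f i x + \sum_(i <- r) co i * f i x);
  last by apply/funext => x; rewrite big_cons.
split.
  rewrite (_ : _ \o _ = ((EFin \o (fun x => (co i * f i x)%R)) \+ (EFin \o (fun x => (\sum_(i <- r) co i * f i x)%R)))%E) //.
  exact: integrableD.
by rewrite RintegralD // RintegralZl // big_cons IH2.
Qed.

Variables (K J : finType) (nu : J -> R) (kappa : R).
Hypothesis kappa_gt0 : 0 < kappa.
Let kappa_neq0 : kappa != 0. Proof. by rewrite gt_eqF. Qed.

(* Fourier transform of [filter_f kappa] *)
Definition gaussian (x : R) : R :=
  Num.sqrt (normal_peak kappa) * expR (- (x ^+ 2 / (4 * kappa ^+ 2))).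

(** A weighted squared Hilbert-Schmidt norm of a filtered operator at frequency w: k will run over
    real and imaginary parts of entries, j over pairs of energy levels. *)
Definition quad (a : K -> R) (b : K -> J -> R) (w : R) : R :=
  \sum_k a k * (\sum_j b k j * gaussian (w - nu j)) ^+ 2.

Lemma quad_ge0 a b w : (forall k, 0 <= a k) -> 0 <= quad a b w.
Proof. by move=> a0; apply: sumr_ge0 => k _; rewrite mulr_ge0 ?sqr_ge0. Qed.

Lemma continuous_gaussian : continuous gaussian.
Proof.
move=> x; apply/differentiable_continuous/derivable1_diffP.
by rewrite /gaussian; apply: ex_derive.
Qed.

Lemma continuous_quad a b : continuous (quad a b).
Proof.
move=> w; apply: continuous_bigsum => k; apply: cvgMl_tmp.
apply: (@continuous_comp _ _ _ (fun w => \sum_j b k j * gaussian (w - nu j)) (fun x => x ^+ 2));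
  last exact: exprn_continuous.
apply: continuous_bigsum => j; apply: cvgMl_tmp.
apply: (@continuous_comp _ _ _ (fun w => w - nu j) gaussian);
  last exact: continuous_gaussian.
by apply: cvgB; [exact: cvg_id|exact: cvg_cst].
Qed.

Lemma measurable_quad d (T : measurableType d) (a : K -> T -> R)
    (b : K -> J -> T -> R) (w : T -> R) :
  (forall k, measurable_fun setT (a k)) ->
  (forall k j, measurable_fun setT (b k j)) -> measurable_fun setT w ->
  measurable_fun setT (fun z => quad (a^~ z) (fun k j => b k j z) (w z)).
Proof.
move=> ma mb mw; apply: measurable_sum => k; apply: measurable_funM => //.
apply: (measurable_funX 2); apply: measurable_sum => j; apply: measurable_funM => //.
apply: (measurableT_comp (continuous_measurable_fun continuous_gaussian)).
exact: measurable_funB.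
Qed.

(** Moving w multiplies each Gaussian by an exponential; X is its part common to all j, and y j is
    absorbed into the coefficients. *)
Lemma quad_shift a b (y : J -> R) (X w w' : R) :
  (forall j, X * gaussian (w' - nu j) = y j * gaussian (w - nu j)) ->
  X ^+ 2 * quad a b w' = quad a (fun k j => b k j * y j) w.
Proof.
move=> H; rewrite /quad mulr_sumr; apply: eq_bigr => k _.
rewrite mulrCA -exprMn; congr (_ * _ ^+ 2).
rewrite mulr_sumr; apply: eq_bigr => j _.
by rewrite mulrCA H mulrA.
Qed.

(** Parseval's identity: expanding the square and replacing every Gaussian overlap by its Fourier
    integral yields the average of the hypothesis over tau, against a normal probability density.
    The splitting cos(x - y) = cos x cos y + sin x sin y reassembles the double sum into two
    squares. *)
Lemma integral_quad_le a b (B : R) :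
  (forall tau, \sum_k a k * ((\sum_j b k j * cos (nu j * tau)) ^+ 2 +
                             (\sum_j b k j * sin (nu j * tau)) ^+ 2) <= B) ->
  (\int[mu]_w (quad a b w)%:E <= B%:E)%E.
Proof.
move=> HB.
pose I := (K * (J * J))%type.
pose co (p : I) := a p.1 * (b p.1 p.2.1 * b p.1 p.2.2).
pose GG (p : I) w := gaussian (w - nu p.2.1) * gaussian (w - nu p.2.2).
pose phi := normal_pdf 0 (2 * kappa)^-1.
pose cc (p : I) t := phi t * cos ((nu p.2.1 - nu p.2.2) * t).
have sqE (x y : J -> R) : (\sum_j x j) * (\sum_j y j) =
    \sum_(p : J * J) x p.1 * y p.2.
  rewrite mulr_suml -(pair_bigA _ (fun i j => x i * y j)) /=.
  by apply: eq_bigr => i _; rewrite mulr_sumr.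
have quadE w : quad a b w = \sum_(p : I) co p * GG p w.
  rewrite /quad -(pair_bigA _ (fun k p => co (k, p) * GG (k, p) w)) /=.
  apply: eq_bigr => k _; rewrite expr2 sqE mulr_sumr; apply: eq_bigr => p _.
  by rewrite /co /GG /=; ring.
have iG p : mu.-integrable setT (EFin \o GG p).
  by have [] := integral_gaussian_overlap (nu p.2.1) (nu p.2.2) kappa_gt0.
have IG p : \int[mu]_w GG p w = \int[mu]_t cc p t.
  by have [] := integral_gaussian_overlap (nu p.2.1) (nu p.2.2) kappa_gt0.
have s0 : 0 < (2 * kappa)^-1 by rewrite invr_gt0 mulr_gt0.
have ic p : mu.-integrable setT (EFin \o cc p).
  apply: integrable_normal_pdf_bounded => //.
    apply: continuous_measurable_fun => t.
    apply: (@continuous_comp _ _ _ (fun t => (nu p.2.1 - nu p.2.2) * t) (@cos R));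
      last exact: continuous_cos.
    by apply: cvgMl_tmp; exact: cvg_id.
  by move=> x; rewrite ler_norml cos_geN1 cos_le1.
have [ig Ig] := integrable_lincomb (index_enum I) co iG.
have [ih Ih] := integrable_lincomb (index_enum I) co ic.
under eq_integral do rewrite quadE.
rewrite -[leLHS](fineK (integrable_fin_num _ ig)) // lee_fin.
rewrite -/(Rintegral mu setT _) Ig.
under eq_bigr do rewrite IG.
rewrite -Ih.
have iB : mu.-integrable setT (EFin \o (fun t => B * phi t)).
  rewrite (_ : _ \o _ = fun x => (B%:E * (phi x)%:E)%E) //.
  by apply: integrableZl => //; exact: integrable_normal_pdf.
apply: (@le_trans _ _ (\int[mu]_t (B * phi t))); last first.
  rewrite RintegralZl //; last exact: integrable_normal_pdf.
  by rewrite /Rintegral integral_normal_pdf /= mulr1.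
apply: le_Rintegral => // t _.
have -> : \sum_p co p * cc p t = phi t *
    \sum_k a k * ((\sum_j b k j * cos (nu j * t)) ^+ 2 +
                  (\sum_j b k j * sin (nu j * t)) ^+ 2).
  rewrite -(pair_bigA _ (fun k p => co (k, p) * cc (k, p) t)) /= mulr_sumr.
  apply: eq_bigr => k _; rewrite !expr2 !sqE -big_split /= !mulr_sumr.
  by apply: eq_bigr => p _; rewrite /co /cc /= mulrBl cosB; ring.
by rewrite mulrC ler_wpM2r ?normal_pdf_ge0.
Qed.
End Quad.

(** * Bounds and translation identities for the frequency weights *)

Section Weights.
Context {R : realType}.
Variables beta kappa : R.
Hypotheses (beta_gt0 : 0 < beta) (kappa_gt0 : 0 < kappa).
Local Notation D := `[(- 2^-1 : R), (2^-1 : R)]%classic.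
Let kappa_neq0 : kappa != 0. Proof. by rewrite gt_eqF. Qed.

Lemma hs_w_ge0 (s w : R) : 0 <= hs_w beta kappa s w.
Proof. by rewrite /hs_w /h_w !mulr_ge0 ?expR_ge0. Qed.

(** With v = w - s beta kappa^2 the logarithm is s beta v - beta |v| / 2 + (s^2 - 1/4) beta^2
    kappa^2 / 2, which is at most 0 for |s| <= 1/2. *)
Lemma hs_w_le1 (s w : R) : D s -> hs_w beta kappa s w <= 1.
Proof.
rewrite /= in_itv /= => /andP[h1 h2].
rewrite /hs_w /h_w -!expRD -[leRHS]expR0 ler_expR.
set v := w - s * beta * kappa ^+ 2.
have -> : w = v + s * beta * kappa ^+ 2 by rewrite /v; ring.
have b2 : 0 <= beta ^+ 2 * kappa ^+ 2 by rewrite mulr_ge0 ?sqr_ge0.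
have hv : s * beta * v <= beta * `|v| / 2.
  apply: (le_trans (ler_norm _)); rewrite !normrM (gtr0_norm beta_gt0).
  have hs : `|s| <= 2^-1 by rewrite ler_norml h1 h2.
  rewrite mulrC mulrA -mulrA mulrC [leRHS]mulrAC -[leRHS]mulrA.
  have : `|s| * (beta * `|v|) <= 2^-1 * (beta * `|v|).
    by rewrite ler_wpM2r // mulr_ge0 // ltW.
  lra.
have hs2 : (beta ^+ 2 * kappa ^+ 2) * s ^+ 2 <= (beta ^+ 2 * kappa ^+ 2) * 4^-1.
  apply: ler_wpM2l => //; nra.
nra.
Qed.

(** Since - max(w, 0) + w/2 = - |w|/2, the translation and the exponential symmetrize the one-sided
    decay of gamma into h. *)
Lemma gamma_shift (w : R) :
  gamma_w beta kappa (w - kappa ^+ 2 * beta / 2) *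
  expR (beta * w / 4 - kappa ^+ 2 * beta ^+ 2 / 16) ^+ 2 = h_w beta kappa w.
Proof.
have -> (x : R) : expR x ^+ 2 = expR (2 * x).
  by rewrite mulr_natl mulr2n expRD.
rewrite /gamma_w /h_w -!expRD; congr (expR _).
rewrite (_ : w - _ + _ = w); last by ring.
by have [w0|w0] := leP 0 w; [rewrite ger0_norm //|rewrite ltr0_norm //]; field.
Qed.

Lemma hs_shift (s w : R) :
  hs_w beta kappa s (w + s * beta * kappa ^+ 2) =
  h_w beta kappa w * expR (s * beta * w / 2 + s ^+ 2 * beta ^+ 2 * kappa ^+ 2 / 4) ^+ 2.
Proof.
have -> (x : R) : expR x ^+ 2 = expR (2 * x).
  by rewrite mulr_natl mulr2n expRD.
by rewrite /hs_w addrK [RHS]mulrC; congr (expR _ * _); field.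
Qed.

(** Expansion of the square. Conjugation by e^{s beta H/2} puts exp(s beta nu / 2) on the component
    of Bohr frequency nu; the identity trades it for a translation of w and a factor free of nu. *)
Lemma gaussian_shift (s w nu : R) :
  expR (s * beta * w / 2 + s ^+ 2 * beta ^+ 2 * kappa ^+ 2 / 4) *
    gaussian kappa (w + s * beta * kappa ^+ 2 - nu) =
  expR (s * (beta * nu) / 2) * gaussian kappa (w - nu).
Proof.
rewrite /gaussian mulrCA [RHS]mulrCA -!expRD; congr (_ * expR _); by field.
Qed.
End Weights.

(** * The two functionals in coordinates *)

(** The integral of a nonnegative function is the supremum over the simple functions below it, and a
    larger function has more of them. This serves for integrands that are themselves integrals. *)
Lemma ge0_le_integral_set d (T : measurableType d) (R : realType)
    (m : {measure set T -> \bar R}) (A : set T) (f g : T -> \bar R) :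
  (forall x, A x -> (0 <= f x)%E) -> (forall x, A x -> (f x <= g x)%E) ->
  (\int[m]_(x in A) f x <= \int[m]_(x in A) g x)%E.
Proof.
move=> f0 fg.
have g0 x : A x -> (0 <= g x)%E by move=> Ax; exact: le_trans (f0 x Ax) (fg x Ax).
rewrite !ge0_integralE //; apply: le_ereal_sup => _ [h hf <-]; exists h => // x.
apply: le_trans (hf x) _; rewrite !patchE; case: ifPn => // /set_mem; exact: fg.
Qed.

Lemma integral_cst_D (R : realType) (r : R) :
  (\int[@lebesgue_measure R]_(s in `[(- 2^-1 : R)%R, (2^-1 : R)%R]) r%:E = r%:E)%E.
Proof.
transitivity (r%:E * @lebesgue_measure R `[(- 2^-1 : R)%R, (2^-1 : R)%R]%classic)%E.
  exact: integral_cst.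
rewrite lebesgue_measure_itv /= lte_fin ifT; last by lra.
by rewrite -EFinB -EFinM; congr EFin; field.
Qed.

Section Main.
Context {R : realType}.
Local Notation mu := (@lebesgue_measure R).
Local Notation D := `[(- 2^-1 : R), (2^-1 : R)]%classic.
Variables (K J : finType) (q eta : K -> R) (nu : J -> R) (c : K -> J -> R -> R).
Variables beta kappa B : R.
Hypotheses (beta_gt0 : 0 < beta) (kappa_gt0 : 0 < kappa).
Hypothesis q_ge0 : forall k, 0 <= q k.
Hypothesis mc : forall k j, measurable_fun setT (c k j).

(** Up to sign, the factor by which the commutator with log sigma - log rho acts on component j of
    entry k. *)
Definition theta k j : R := eta k + beta * nu j.

(** In the application this is p_i^{1/2+s} p_j^{1/2-s} for eigenvalues p_i, p_j of sigma. *)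
Definition amp (s : R) (k : K) : R := q k * expR (s * eta k).

Hypothesis amp_le : forall s t tau, D s ->
  \sum_k amp s k * ((\sum_j c k j t * theta k j * cos (nu j * tau)) ^+ 2 +
                    (\sum_j c k j t * theta k j * sin (nu j * tau)) ^+ 2) <= B.

Definition fisher_form (s w t : R) : R :=
  quad nu kappa (amp s) (fun k j => c k j t * theta k j) w.

(** The squared norm of Y(s); the added exponential is the conjugation by e^{s beta H/2}. *)
Definition fisher_form_shifted (s w t : R) : R :=
  quad nu kappa (amp s)
    (fun k j => c k j t * theta k j * expR (s * (beta * nu j) / 2)) w.

(** In the two terms of the balance defect an entry gets the factors exp(x_j/2) and exp(x_i/2 + beta
    nu/2), where x is the logarithm of the spectrum of sigma. Their geometric mean is taken out; its
    part exp((x_i + x_j)/4) squares to q, and 2 sinh(theta/4) remains. *)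
Definition balance_form (w t : R) : R :=
  quad nu kappa q (fun k j => c k j t *
    (expR (beta * nu j / 4) * (expR (theta k j / 4) - expR (- (theta k j / 4))))) w.

Definition balance_form_shifted (w t : R) : R :=
  quad nu kappa q (fun k j => c k j t *
    (expR (theta k j / 4) - expR (- (theta k j / 4)))) w.

Lemma amp_ge0 s k : 0 <= amp s k.
Proof. by rewrite mulr_ge0 // expR_ge0. Qed.

Lemma fisher_form_ge0 s w t : 0 <= fisher_form s w t.
Proof. by apply: quad_ge0 => k; exact: amp_ge0. Qed.

Lemma fisher_form_shiftE (s w t : R) :
  hs_w beta kappa s (w + s * beta * kappa ^+ 2) *
    fisher_form s (w + s * beta * kappa ^+ 2) t =
  h_w beta kappa w * fisher_form_shifted s w t.
Proof.
rewrite hs_shift // -[LHS]mulrA; congr (_ * _).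
by apply: quad_shift => j; exact: gaussian_shift.
Qed.

(** The case s = -1/2 of [gaussian_shift] removes the factor exp(beta nu / 4), and [gamma_shift]
    accounts for the weight. *)
Lemma balance_form_shiftE (w t : R) :
  gamma_w beta kappa (w - kappa ^+ 2 * beta / 2) *
    balance_form (w - kappa ^+ 2 * beta / 2) t =
  h_w beta kappa w * balance_form_shifted w t.
Proof.
rewrite -gamma_shift // -[RHS]mulrA; congr (_ * _).
set X := expR _; have X0 : X != 0 by rewrite gt_eqF // expR_gt0.
have H j : X * gaussian kappa (w - nu j) =
    expR (beta * nu j / 4) * gaussian kappa (w - kappa ^+ 2 * beta / 2 - nu j).
  have := gaussian_shift beta kappa_gt0 (- 2^-1) w (nu j).
  rewrite (_ : w + - 2^-1 * beta * kappa ^+ 2 = w - kappa ^+ 2 * beta / 2); last by ring.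
  set Y := expR _; set Z := expR _ => YZ.
  have YX : Y = X^-1.
    by rewrite /Y /X -expRN; congr expR; field.
  have ZE : Z = (expR (beta * nu j / 4))^-1.
    by rewrite /Z -expRN; congr expR; field.
  have e0 : expR (beta * nu j / 4) != 0 by rewrite gt_eqF // expR_gt0.
  have -> : gaussian kappa (w - kappa ^+ 2 * beta / 2 - nu j) =
    X * (Y * gaussian kappa (w - kappa ^+ 2 * beta / 2 - nu j)).
    by rewrite YX mulrA divff // mul1r.
  by rewrite YZ ZE [RHS]mulrCA mulVKf.
rewrite /balance_form_shifted (quad_shift _ _ H) /balance_form.
congr quad; apply/funext => k; apply/funext => j; ring.
Qed.

Lemma measurable_hs_w d (T : measurableType d) (fs fw : T -> R) :
  measurable_fun setT fs -> measurable_fun setT fw ->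
  measurable_fun setT (fun z => hs_w beta kappa (fs z) (fw z)).
Proof.
move=> ms mw; rewrite /hs_w /h_w.
apply: measurable_funM.
  apply: (measurableT_comp (@measurable_expR R)).
  apply: measurable_funM => //; apply: measurable_funM.
    exact: measurable_funM.
  apply: measurable_funB; first exact: measurable_funM.
  by do !apply: measurable_funM.
apply: measurable_funM => //.
apply: (measurableT_comp (@measurable_expR R)).
apply: measurable_funN; apply: measurable_funM => //; apply: measurable_funM => //.
apply: (measurableT_comp (continuous_measurable_fun (@norm_continuous _ R))).
apply: measurable_funB => //.
by do !apply: measurable_funM.
Qed.

Lemma measurable_gs_w d (T : measurableType d) (fs ft : T -> R) :
  measurable_fun setT fs -> measurable_fun setT ft ->
  measurable_fun setT (fun z => gs_w beta (fs z) (ft z)).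
Proof.
move=> ms mt; rewrite /gs_w.
have mcos (f : T -> R) : measurable_fun setT f -> measurable_fun setT (fun z => cos (f z)).
  by move=> mf; apply: (measurableT_comp (continuous_measurable_fun (@continuous_cos R))).
have mcosh (f : T -> R) : measurable_fun setT f -> measurable_fun setT (fun z => cosh (f z)).
  move=> mf; rewrite /cosh; apply: measurable_funM => //.
  apply: measurable_funD; first by apply: (measurableT_comp (@measurable_expR R)).
  by apply: (measurableT_comp (@measurable_expR R)); exact: measurable_funN.
apply: measurable_funM => //; apply: measurable_funM.
  apply: measurable_funM; first by apply: mcos; exact: measurable_funM.
  by apply: mcosh; do !apply: measurable_funM.
apply: measurable_funV_ge0.
  apply: measurable_funD; first by apply: mcosh; do !apply: measurable_funM.
  by apply: mcos; do !apply: measurable_funM.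
move=> z; have := cosh_ge1 (4 * pi * ft z / beta).
have := cos_geN1 (2 * fs z * pi); lra.
Qed.

Lemma measurable_amp d (T : measurableType d) (fs : T -> R) k :
  measurable_fun setT fs -> measurable_fun setT (fun z => amp (fs z) k).
Proof.
move=> ms; apply: measurable_funM => //.
by apply: (measurableT_comp (@measurable_expR R)); exact: measurable_funM.
Qed.

Lemma measurable_fisher_form d (T : measurableType d) (fs fw ft : T -> R) :
  measurable_fun setT fs -> measurable_fun setT fw -> measurable_fun setT ft ->
  measurable_fun setT (fun z => fisher_form (fs z) (fw z) (ft z)).
Proof.
move=> ms mw mt.
have := @measurable_quad _ _ _ nu kappa _ _ (fun k z => amp (fs z) k)
  (fun k j z => c k j (ft z) * theta k j) fw.
apply => //.
  by move=> k; exact: measurable_amp.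
by move=> k j; apply: measurable_funM => //; exact: measurableT_comp.
Qed.

Lemma measurable_fisher_form_shifted d (T : measurableType d) (fs fw ft : T -> R) :
  measurable_fun setT fs -> measurable_fun setT fw -> measurable_fun setT ft ->
  measurable_fun setT (fun z => fisher_form_shifted (fs z) (fw z) (ft z)).
Proof.
move=> ms mw mt.
have := @measurable_quad _ _ _ nu kappa _ _ (fun k z => amp (fs z) k)
  (fun k j z => c k j (ft z) * theta k j * expR (fs z * (beta * nu j) / 2)) fw.
apply => //.
  by move=> k; exact: measurable_amp.
move=> k j; apply: measurable_funM.
  by apply: measurable_funM => //; exact: measurableT_comp.
apply: (measurableT_comp (@measurable_expR R)).
by apply: measurable_funM => //; exact: measurable_funM.
Qed.

Lemma continuous_h_w : continuous (h_w beta kappa).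
Proof.
move=> w; rewrite /h_w; apply: cvgMl_tmp.
apply: (@continuous_comp _ _ _ (fun w => - (beta * `|w| / 2)) (@expR R));
  last exact: continuous_expR.
apply: cvgN; apply: cvgMr_tmp; apply: cvgMl_tmp; exact: norm_continuous.
Qed.

Lemma continuous_hs_w (s : R) : continuous (hs_w beta kappa s).
Proof.
move=> w.
have c1 : {for w, continuous (fun w : R =>
    expR (s * beta * (2 * w - s * beta * kappa ^+ 2) / 2))}.
  apply: (@continuous_comp _ _ _ (fun w : R => s * beta * (2 * w - s * beta * kappa ^+ 2) / 2) (@expR R));
    last exact: continuous_expR.
  apply: cvgMr_tmp; apply: cvgMl_tmp; apply: cvgB; last exact: cvg_cst.
  by apply: cvgMl_tmp; exact: cvg_id.
have c2 : {for w, continuous (fun w : R => h_w beta kappa (w - s * beta * kappa ^+ 2))}.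
  apply: (@continuous_comp _ _ _ (fun w : R => w - s * beta * kappa ^+ 2) (h_w beta kappa));
    last exact: continuous_h_w.
  by apply: cvgB; [exact: cvg_id|exact: cvg_cst].
exact: cvgM c1 c2.
Qed.

Lemma continuous_gamma_w : continuous (gamma_w beta kappa).
Proof.
have -> : gamma_w beta kappa = fun w => expR (- (beta *
   ((w + beta * kappa ^+ 2 / 2 + `|w + beta * kappa ^+ 2 / 2|) / 2))).
  by apply/funext => w; rewrite /gamma_w maxr_absE addr0 subr0.
move=> w.
apply: (@continuous_comp _ _ _ (fun w => - (beta *
   ((w + beta * kappa ^+ 2 / 2 + `|w + beta * kappa ^+ 2 / 2|) / 2))) (@expR R));
  last exact: continuous_expR.
have cl : {for w, continuous (fun w : R => w + beta * kappa ^+ 2 / 2)}.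
  by apply: cvgD; [exact: cvg_id|exact: cvg_cst].
apply: cvgN; apply: cvgMl_tmp; apply: cvgMr_tmp; apply: cvgD; first exact: cl.
apply: (@continuous_comp _ _ _ (fun w : R => w + beta * kappa ^+ 2 / 2) (@Num.norm _ R));
  [exact: cl|exact: norm_continuous].
Qed.

(** Duhamel's formula entry by entry: 2 sinh(theta/4) is the increment over D of s -> exp(theta
    s/2). In the derivative, theta = eta + beta nu splits the exponential into a part that squares
    into [amp] and the conjugation factor; 1/4 is the square of the 1/2 in theta/2. *)
Lemma balance_form_shifted_le (w t d : R) : 0 < d ->
  ((balance_form_shifted w t)%:E <= (weight_mass d)%:E *
   \int[mu]_(s in D) (weight d s * (4^-1 * fisher_form_shifted s w t))%:E)%E.
Proof.
move=> d0.
pose u k s := \sum_j (c k j t * gaussian kappa (w - nu j)) * expR (theta k j * s / 2).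
pose u' k s := \sum_j (c k j t * gaussian kappa (w - nu j)) *
   (theta k j / 2 * expR (theta k j * s / 2)).
have du k (x : R) : is_derive x 1 (u k) (u' k x).
  apply: is_derive_bigsum => j.
  by apply: is_derive_eq; rewrite /GRing.scale /=; ring.
have cu' k : continuous (u' k).
  move=> x; apply: continuous_bigsum => j; apply: cvgMl_tmp; apply: cvgMl_tmp.
  apply: (@continuous_comp _ _ _ (fun x => theta k j * x / 2) (@expR R));
    last exact: continuous_expR.
  by apply: cvgMr_tmp; apply: cvgMl_tmp; exact: cvg_id.
have := weighted_FTC d0 q_ge0 du cu'.
congr (_%:E <= _ * _)%E.
  rewrite /balance_form_shifted /quad; apply: eq_bigr => k _; congr (_ * _ ^+ 2).
  rewrite -sumrB; apply: eq_bigr => j _.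
  rewrite (_ : theta k j / 2 / 2 = theta k j / 4); last by field.
  rewrite (_ : theta k j * - 2^-1 / 2 = - (theta k j / 4)); last by field.
  by ring.
apply: eq_integral => s _; congr (_ * _)%:E.
rewrite /fisher_form_shifted /quad mulr_sumr; apply: eq_bigr => k _.
rewrite /amp.
have -> : u' k s = 2^-1 * expR (s * eta k / 2) *
  \sum_j c k j t * theta k j * expR (s * (beta * nu j) / 2) * gaussian kappa (w - nu j).
  rewrite /u' mulr_sumr; apply: eq_bigr => j _.
  rewrite (_ : theta k j * s / 2 = s * eta k / 2 + s * (beta * nu j) / 2); last by rewrite /theta; ring.
  by rewrite expRD; ring.
set S := \sum_j _.
have -> : expR (s * eta k) = expR (s * eta k / 2) ^+ 2.
  by rewrite expr2 -expRD; congr expR; field.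
by field.
Qed.

Definition fisher_density (t w s : R) : R :=
  fisher_form s w t * hs_w beta kappa s w * gs_w beta s t.

Lemma fisher_density_ge0 t w s : D s -> 0 <= fisher_density t w s.
Proof.
move=> sD; apply: mulr_ge0; last exact: gs_w_ge0.
by apply: mulr_ge0; [exact: fisher_form_ge0|exact: hs_w_ge0].
Qed.

Lemma measurable_fisher_density d (T : measurableType d) (fs fw ft : T -> R) :
  measurable_fun setT fs -> measurable_fun setT fw -> measurable_fun setT ft ->
  measurable_fun setT (fun z => fisher_density (ft z) (fw z) (fs z)).
Proof.
move=> ms mw mt; apply: measurable_funM; last exact: measurable_gs_w.
apply: measurable_funM; first exact: measurable_fisher_form.
exact: measurable_hs_w.
Qed.

Lemma integral_fisher_form_le (s t : R) : D s ->
  (\int[mu]_w (fisher_form s w t)%:E <= B%:E)%E.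
Proof.
move=> sD; apply: integral_quad_le => // tau; exact: amp_le.
Qed.

Lemma B_ge0 : 0 <= B.
Proof.
have D0 : D 0 by rewrite /= in_itv /=; lra.
rewrite -lee_fin; apply: le_trans (@integral_fisher_form_le 0 0 D0).
by apply: integral_ge0 => w _; rewrite lee_fin fisher_form_ge0.
Qed.

Lemma continuous_fisher_form s t : continuous (fun w => fisher_form s w t).
Proof. exact: continuous_quad. Qed.

Definition balance_density (t w : R) : R :=
  balance_form w t * gamma_w beta kappa w * g_w beta t.

Let amp_expand_ge0 (d t w s : R) : 0 < d -> D s ->
  0 <= h_w beta kappa w * g_w beta t * weight_mass d *
       (weight d s * (4^-1 * fisher_form_shifted s w t)).
Proof.
move=> d0 sD; apply: mulr_ge0.
  apply: mulr_ge0; last by rewrite ltW // weight_mass_gt0.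
  by apply: mulr_ge0; [rewrite mulr_ge0 ?expR_ge0|rewrite ltW // g_w_gt0].
apply: mulr_ge0; first by rewrite ltW // weight_gt0.
by apply: mulr_ge0; [rewrite invr_ge0|apply: quad_ge0 => k; exact: amp_ge0].
Qed.

Let weight_le (d t s : R) : 0 < d -> D s ->
  weight d s * g_w beta t <=
  4 * gs_w beta s t + (2 * d + d ^+ 2) * g_w beta t.
Proof.
move=> d0 sD; have g0 := g_w_gt0 beta_gt0 t.
have := gs_w_ge beta_gt0 t sD; have := cos_pi_ge sD.
rewrite (mulrC pi) /weight => h1 h2; nra.
Qed.

Let measurable_integral_fisher_density t :
  measurable_fun D (fun s => \int[mu]_w (fisher_density t w s)%:E)%E.
Proof.
pose f (z : R * R) := fisher_density t z.2 z.1 * \1_D z.1.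
apply: (eq_measurable_fun (fun s => \int[mu]_(w in setT) (f (s, w))%:E)%E).
  by move=> s sD; apply: eq_integral => w _; rewrite /f indicE /= sD mulr1.
apply: measurable_funTS; apply: measurable_fun_integral_itv => //.
  apply: measurable_funM.
    exact: measurable_fisher_density.
  apply: measurableT_comp; last exact: measurable_fst.
  exact: measurable_indic.
move=> s w _; rewrite /f indicE /=; have [/set_mem sD|_] := boolP (s \in D).
  by rewrite mulr1 fisher_density_ge0.
by rewrite mulr0.
Qed.

Let measurable_fisher_density_w t s :
  measurable_fun setT (fun w => (fisher_density t w s)%:E).
Proof. by apply/measurable_EFinP; exact: measurable_fisher_density. Qed.

(** The translation of w that undoes the conjugation depends on s. Tonelli's theorem therefore makes
    w the inner variable first, and restores the order once the translation is done. *)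
Lemma integral_balance_density_le (d t : R) : 0 < d ->
  (\int[mu]_w (balance_density t w)%:E <=
   (weight_mass d)%:E * \int[mu]_w \int[mu]_(s in D) (fisher_density t w s)%:E +
   (weight_mass d * (d / 2 + d ^+ 2 / 4) * B * g_w beta t)%:E)%E.
Proof.
move=> d0; have g0 := g_w_gt0 beta_gt0 t.
have l0 := weight_mass_gt0 d0; set l := weight_mass d in l0 *.
have mD : measurable D by exact: measurable_itv.
pose V (z : R * R) := h_w beta kappa z.1 * g_w beta t * l *
       (weight d z.2 * (4^-1 * fisher_form_shifted z.2 z.1 t)).
have V0 w s : D s -> 0 <= V (w, s) by move=> sD; exact: amp_expand_ge0.
have mweight : measurable_fun setT (weight d).
  apply: measurable_funB => //; apply: measurable_funM => //.
have mfs : measurable_fun setT (fun z : R * R => fisher_form_shifted z.2 z.1 t).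
  exact: measurable_fisher_form_shifted.
have mV : measurable_fun setT V.
  apply: measurable_funM.
    apply: measurable_funM => //; apply: measurable_funM => //.
    apply: measurableT_comp; last exact: measurable_fst.
    exact: (continuous_measurable_fun continuous_h_w).
  apply: measurable_funM.
    by apply: measurableT_comp => //; exact: measurable_snd.
  exact: measurable_funM.
pose Vs s w := g_w beta t * l * weight d s * 4^-1 *
  (hs_w beta kappa s w * fisher_form s w t).
have Vs0 s w : D s -> 0 <= Vs s w.
  move=> sD; apply: mulr_ge0.
    apply: mulr_ge0; last by rewrite invr_ge0.
    apply: mulr_ge0; last by rewrite ltW // weight_gt0.
    by apply: mulr_ge0; exact: ltW.
  by apply: mulr_ge0; [exact: hs_w_ge0|exact: fisher_form_ge0].
have cVs s : continuous (Vs s).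
  move=> w; apply: cvgMl_tmp; apply: cvgM; first exact: continuous_hs_w.
  exact: continuous_fisher_form.
(* The coefficient l/4 of the form times the excess 2d + d^2 of the weight. *)
pose C := l * (d / 2 + d ^+ 2 / 4) * g_w beta t.
have C0 : 0 <= C.
  apply: mulr_ge0; last exact: ltW.
  apply: mulr_ge0; first exact: ltW.
  by rewrite addr_ge0 // divr_ge0 ?sqr_ge0 // ltW.
have VsE s : D s -> (\int[mu]_w (V (w, s))%:E <=
    l%:E * \int[mu]_w (fisher_density t w s)%:E + (C * B)%:E)%E.
  move=> sD.
  (* The translation by s beta kappa^2 exchanges h with the conjugated form for h_s with the
     original one. *)
  have -> : (\int[mu]_w (V (w, s))%:E = \int[mu]_w (Vs s w)%:E)%E.
    rewrite -(@ge0_integral_shift _ (Vs s) (s * beta * kappa ^+ 2)) //; last first.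
      by move=> w; exact: Vs0.
    apply: eq_integral => w _; congr EFin.
    rewrite /Vs /V (fisher_form_shiftE s w t) /=.
    move: (h_w _ _ _) (fisher_form_shifted _ _ _) (weight _ _) (g_w _ _).
    by move=> a b W g; ring.
  apply: (@le_trans _ _ (\int[mu]_w (l%:E * (fisher_density t w s)%:E +
      C%:E * (fisher_form s w t)%:E))%E).
    apply: ge0_le_integral_set => w _; first by rewrite lee_fin Vs0.
    rewrite -!EFinM -EFinD lee_fin /Vs /C /fisher_density.
    have P0 := fisher_form_ge0 s w t; have h0 := hs_w_ge0 beta kappa s w.
    have h1 := hs_w_le1 kappa beta_gt0 w sD; have wl := weight_le t d0 sD.
    move: wl P0 h0 h1; move: (weight d s) (fisher_form s w t) (hs_w _ _ _ _) (gs_w _ _ _).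
    move=> W P h gs wl P0 h0 h1.
    apply: (@le_trans _ _ (l / 4 * (h * P) * (4 * gs + (2 * d + d ^+ 2) * g_w beta t))).
      rewrite (_ : g_w beta t * l * W / 4 * (h * P) = l / 4 * (h * P) * (W * g_w beta t)); last by ring.
      apply: ler_wpM2l => //; apply: mulr_ge0; last exact: mulr_ge0.
      by apply: mulr_ge0; [exact: ltW|rewrite invr_ge0].
    rewrite mulrDr (_ : l / 4 * (h * P) * (4 * gs) = l * (P * h * gs)); last by field.
    rewrite lerD2l.
    rewrite (_ : l / 4 * (h * P) * ((2 * d + d ^+ 2) * g_w beta t) =
       l * (d / 2 + d ^+ 2 / 4) * g_w beta t * (h * P)); last by field.
    by apply: ler_wpM2l => //; rewrite ler_piMl.
  rewrite ge0_integralD //; first last.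
  - apply: emeasurable_funM => //; apply/measurable_EFinP.
    exact: measurable_fisher_form.
  - by move=> w _; rewrite -EFinM lee_fin mulr_ge0 ?fisher_form_ge0.
  - by apply: emeasurable_funM; [exact: measurable_cst|exact: measurable_fisher_density_w].
  - by move=> w _; rewrite -EFinM lee_fin mulr_ge0 ?(ltW l0) ?fisher_density_ge0.
  rewrite ge0_integralZl_EFin //; first last.
  - exact: ltW.
  - exact: measurable_fisher_density_w.
  - by move=> w _; rewrite lee_fin fisher_density_ge0.
  rewrite ge0_integralZl_EFin //; first last.
  - by apply/measurable_EFinP; exact: measurable_fisher_form.
  - by move=> w _; rewrite lee_fin fisher_form_ge0.
  apply: leeD2l; rewrite [(C * B)%:E]EFinM; apply: lee_wpmul2l; first by rewrite lee_fin.
  exact: integral_fisher_form_le.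
have E1 : (\int[mu]_w (balance_density t w)%:E =
  \int[mu]_w (h_w beta kappa w * g_w beta t * balance_form_shifted w t)%:E)%E.
  rewrite -(@ge0_integral_shift _ (balance_density t) (- (kappa ^+ 2 * beta / 2))).
  - apply: eq_integral => w _; congr EFin.
    rewrite /balance_density -[RHS]mulrAC -balance_form_shiftE.
    by rewrite [_ * gamma_w _ _ _]mulrC.
  - move=> w; apply: cvgMr_tmp; apply: cvgM; last exact: continuous_gamma_w.
    exact: continuous_quad.
  - move=> w; apply: mulr_ge0; last exact: ltW.
    by apply: mulr_ge0; [exact: quad_ge0|exact: expR_ge0].
rewrite E1.
apply: (@le_trans _ _ (\int[mu]_w \int[mu]_(s in D) (V (w, s))%:E)%E).
  apply: ge0_le_integral_set => w _.
    rewrite lee_fin mulr_ge0 ?quad_ge0 //.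
    by rewrite mulr_ge0 ?(ltW g0) // mulr_ge0 ?expR_ge0.
  have hg0 : 0 <= h_w beta kappa w * g_w beta t.
    by rewrite mulr_ge0 ?(ltW g0) // mulr_ge0 ?expR_ge0.
  rewrite EFinM.
  apply: (@le_trans _ _ ((h_w beta kappa w * g_w beta t)%:E * (l%:E *
    \int[mu]_(s in D) (weight d s * (4^-1 * fisher_form_shifted s w t))%:E))%E).
    by apply: lee_wpmul2l; [rewrite lee_fin|exact: balance_form_shifted_le].
  rewrite muleA -EFinM -ge0_integralZl_EFin //.
  - move=> s sD; rewrite lee_fin mulr_ge0 ?(ltW (weight_gt0 d0 sD)) //.
    by rewrite mulr_ge0 ?invr_ge0 // quad_ge0 // => k; exact: amp_ge0.
  - apply: measurable_funTS; apply/measurable_EFinP; apply: measurable_funM => //.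
    apply: measurable_funM => //; exact: measurable_fisher_form_shifted.
  - by rewrite mulr_ge0 // ltW.
rewrite ge0_tonelli_itv //.
apply: (@le_trans _ _ (\int[mu]_(s in D)
   (l%:E * \int[mu]_w (fisher_density t w s)%:E + (C * B)%:E))%E).
  apply: ge0_le_integral_set => s sD; last exact: VsE.
  by apply: integral_ge0 => w _; rewrite lee_fin; exact: V0.
have CB0 : 0 <= C * B by rewrite mulr_ge0 // B_ge0.
have I0 s : D s -> (0 <= \int[mu]_w (fisher_density t w s)%:E)%E.
  by move=> sD; apply: integral_ge0 => w _; rewrite lee_fin fisher_density_ge0.
rewrite ge0_integralD //; first last.
- by apply: emeasurable_funM => //; exact: measurable_integral_fisher_density.
- by move=> s sD; apply: mule_ge0; [rewrite lee_fin ltW|exact: I0].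
rewrite ge0_integralZl_EFin //; first last.
- exact: ltW.
- exact: measurable_integral_fisher_density.
have mfd : measurable_fun setT (fun z : R * R => fisher_density t z.1 z.2).
  exact: measurable_fisher_density.
rewrite -(@ge0_tonelli_itv _ D (fun z => fisher_density t z.1 z.2)) //; last first.
  by move=> w s sD; exact: fisher_density_ge0.
apply: leeD2l; rewrite integral_cst_D.
by rewrite lee_fin /C [leRHS]mulrAC.
Qed.

Let measurable_fisher_density2 :
  measurable_fun setT (fun z : R * R * R => fisher_density z.1.1 z.1.2 z.2).
Proof.
apply: measurable_fisher_density => //.
- exact: measurableT_comp measurable_snd measurable_fst.
- exact: measurableT_comp measurable_fst measurable_fst.
Qed.

Let measurable_integral2_fisher_density :
  measurable_fun setT (fun t =>
    \int[mu]_w \int[mu]_(s in D) (fisher_density t w s)%:E)%E.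
Proof.
pose F (z : R * R) := (\int[mu]_(s in D) (fisher_density z.1 z.2 s)%:E)%E.
have F0 z : (0 <= F z)%E.
  by apply: integral_ge0 => s sD; rewrite lee_fin fisher_density_ge0.
have mF : measurable_fun setT F.
  apply: (@measurable_fun_integral_itv _ _ _ D
    (fun z : R * R * R => fisher_density z.1.1 z.1.2 z.2)) => //.
  by move=> z s sD; exact: fisher_density_ge0.
exact: (@measurable_fun_fubini_tonelli_F _ _ _ _ _ mu F mF F0).
Qed.

Let D0 : D 0.
Proof. by rewrite /= in_itv /= oppr_le0 invr_ge0 ler0n. Qed.

Let measurable_g_w : measurable_fun setT (fun t => (g_w beta t)%:E).
Proof.
apply/measurable_EFinP; rewrite (_ : g_w beta = fun t => gs_w beta 0 t).
  exact: measurable_gs_w.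
by apply/funext => t; rewrite gs_w0.
Qed.

Lemma integral_g_w_le : (\int[mu]_t (g_w beta t)%:E <= (2^-1)%:E)%E.
Proof.
by under eq_integral do rewrite -(gs_w0 beta_gt0); exact: integral_gs_w.
Qed.

Lemma integral2_balance_density_le (d : R) : 0 < d ->
  (\int[mu]_t \int[mu]_w (balance_density t w)%:E <=
   (weight_mass d)%:E *
     \int[mu]_t \int[mu]_w \int[mu]_(s in D) (fisher_density t w s)%:E +
   (weight_mass d * (d / 2 + d ^+ 2 / 4) * B / 2)%:E)%E.
Proof.
move=> d0; have l0 := weight_mass_gt0 d0.
set l := weight_mass d in l0 *.
pose C := l * (d / 2 + d ^+ 2 / 4) * B.
have C0 : 0 <= C.
  apply: mulr_ge0; last exact: B_ge0.
  apply: mulr_ge0; first exact: ltW.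
  by rewrite addr_ge0 // divr_ge0 ?sqr_ge0 // ltW.
have I0 t : (0 <= \int[mu]_w \int[mu]_(s in D) (fisher_density t w s)%:E)%E.
  apply: integral_ge0 => w _; apply: integral_ge0 => s sD.
  by rewrite lee_fin fisher_density_ge0.
apply: (@le_trans _ _ (\int[mu]_t
  (l%:E * \int[mu]_w \int[mu]_(s in D) (fisher_density t w s)%:E +
   C%:E * (g_w beta t)%:E))%E).
  apply: ge0_le_integral_set => t _.
    apply: integral_ge0 => w _; rewrite lee_fin.
    apply: mulr_ge0; last exact/ltW/g_w_gt0.
    by apply: mulr_ge0; [exact: quad_ge0|exact: expR_ge0].
  exact: integral_balance_density_le.
rewrite ge0_integralD //; first last.
- by apply: emeasurable_funM; [exact: measurable_cst|exact: measurable_g_w].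
- by move=> t _; rewrite -EFinM lee_fin mulr_ge0 // ltW // g_w_gt0.
- by apply: emeasurable_funM; [exact: measurable_cst|exact: measurable_integral2_fisher_density].
- by move=> t _; apply: mule_ge0 => //; rewrite lee_fin ltW.
rewrite ge0_integralZl_EFin //; last exact: ltW.
apply: leeD2l; rewrite ge0_integralZl_EFin //; last first.
  by move=> t _; rewrite lee_fin ltW // g_w_gt0.
rewrite [leRHS]EFinM; apply: lee_wpmul2l; first by rewrite lee_fin.
exact: integral_g_w_le.
Qed.

(** Replaces h_s by 1, the integral of the form over w by B and the mass of g_s by 1/2; D has length
    1. In particular the Fisher information is finite. *)
Lemma integral2_fisher_density_le :
  (\int[mu]_t \int[mu]_w \int[mu]_(s in D) (fisher_density t w s)%:E <=
   (B / 2)%:E)%E.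
Proof.
have mD : measurable D by exact: measurable_itv.
have mgs : measurable_fun setT (fun z : R * R => gs_w beta z.2 z.1).
  exact: measurable_gs_w.
apply: (@le_trans _ _ (\int[mu]_t \int[mu]_(s in D) (B * gs_w beta s t)%:E)%E).
  apply: ge0_le_integral_set => t _.
    apply: integral_ge0 => w _; apply: integral_ge0 => s sD.
    by rewrite lee_fin fisher_density_ge0.
  have mfd : measurable_fun setT (fun z : R * R => fisher_density t z.1 z.2).
    exact: measurable_fisher_density.
  rewrite (@ge0_tonelli_itv _ D (fun z => fisher_density t z.1 z.2)) //; last first.
    by move=> w s sD; exact: fisher_density_ge0.
  apply: ge0_le_integral_set => s sD.
    by apply: integral_ge0 => w _; rewrite lee_fin fisher_density_ge0.
  have gs0 := gs_w_ge0 beta_gt0 t sD.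
  apply: (@le_trans _ _ (\int[mu]_w ((gs_w beta s t)%:E * (fisher_form s w t)%:E))%E).
    apply: ge0_le_integral_set => w _; first by rewrite lee_fin fisher_density_ge0.
    rewrite -EFinM lee_fin /fisher_density mulrC ler_wpM2l //.
    by rewrite ler_piMr ?fisher_form_ge0 // hs_w_le1.
  rewrite ge0_integralZl_EFin //; last 2 first.
  - by move=> w _; rewrite lee_fin fisher_form_ge0.
  - by apply/measurable_EFinP; exact: measurable_fisher_form.
  rewrite [B * _]mulrC [leRHS]EFinM; apply: lee_wpmul2l; first by rewrite lee_fin.
  exact: integral_fisher_form_le.
have B0 := B_ge0.
rewrite (@ge0_tonelli_itv _ D (fun z => B * gs_w beta z.2 z.1)) //; last 2 first.
- exact: measurable_funM.
- by move=> t s sD; rewrite mulr_ge0 // gs_w_ge0.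
apply: (@le_trans _ _ (\int[mu]_(s in D) (B / 2)%:E)%E).
  apply: ge0_le_integral_set => s sD.
    by apply: integral_ge0 => t _; rewrite lee_fin mulr_ge0 // gs_w_ge0.
  rewrite [leLHS](_ : _ = (\int[mu]_t (B%:E * (gs_w beta s t)%:E))%E) //.
  rewrite ge0_integralZl_EFin //; last 2 first.
  - by move=> t _; rewrite lee_fin gs_w_ge0.
  - by apply/measurable_EFinP; exact: measurable_gs_w.
  rewrite [leRHS]EFinM; apply: lee_wpmul2l; first by rewrite lee_fin.
  exact: integral_gs_w.
by rewrite integral_cst_D.
Qed.

End Main.

(** * Matrices over the complex numbers *)

Local Notation normc := Normc.normc.

Section ComplexLemmas.
Context {R : realType}.
Local Notation C := R[i].
Local Notation Re := (@complex.Re R).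
Local Notation Im := (@complex.Im R).

Lemma conjCE (z : C) : Num.conj z = (Re z -i* Im z).
Proof. by case: z. Qed.

Lemma complexReD (z w : C) : Re (z + w) = Re z + Re w. Proof. by case: z; case: w. Qed.
Lemma complexImD (z w : C) : Im (z + w) = Im z + Im w. Proof. by case: z; case: w. Qed.
Lemma complexReM (z w : C) : Re (z * w) = Re z * Re w - Im z * Im w.
Proof. by case: z; case: w. Qed.
Lemma complexImM (z w : C) : Im (z * w) = Re z * Im w + Im z * Re w.
Proof. by case: z => a b; case: w => c d /=; rewrite addrC. Qed.
Lemma complexRe_sum (I : Type) (r : seq I) (f : I -> C) :
  Re (\sum_(i <- r) f i) = \sum_(i <- r) Re (f i).
Proof. by elim: r => [|i r IH]; rewrite ?big_nil // !big_cons complexReD IH. Qed.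
Lemma complexIm_sum (I : Type) (r : seq I) (f : I -> C) :
  Im (\sum_(i <- r) f i) = \sum_(i <- r) Im (f i).
Proof. by elim: r => [|i r IH]; rewrite ?big_nil // !big_cons complexImD IH. Qed.
Lemma complexReZ (a : R) (z : C) : Re (a%:C * z) = a * Re z.
Proof. by case: z => x y /=; rewrite mul0r subr0. Qed.
Lemma complexImZ (a : R) (z : C) : Im (a%:C * z) = a * Im z.
Proof. by case: z => x y /=; rewrite mul0r addr0. Qed.
Lemma conjC_realC (a : R) : Num.conj (a%:C : C) = a%:C.
Proof. by rewrite conjCE /= oppr0. Qed.

Definition sqm (z : C) : R := Re z ^+ 2 + Im z ^+ 2.

Lemma sqm_ge0 z : 0 <= sqm z. Proof. by rewrite addr_ge0 ?sqr_ge0. Qed.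
Lemma sqmM z w : sqm (z * w) = sqm z * sqm w.
Proof. by rewrite /sqm complexReM complexImM; ring. Qed.
Lemma sqmN z : sqm (- z) = sqm z.
Proof. by case: z => a b; rewrite /sqm /= !sqrrN. Qed.
Lemma sqm_conj z : sqm (Num.conj z) = sqm z.
Proof. by rewrite conjCE /sqm /= sqrrN. Qed.
Lemma sqm_realC (a : R) : sqm (a%:C) = a ^+ 2.
Proof. by rewrite /sqm /= expr0n addr0. Qed.
Lemma Re_conjM z : Re (Num.conj z * z) = sqm z.
Proof. by rewrite conjCE complexReM /sqm /=; ring. Qed.
Lemma sqmB_le z w : sqm (z - w) <= 2 * sqm z + 2 * sqm w.
Proof.
case: z => a b; case: w => c d; rewrite /sqm /= -subr_ge0.
rewrite (_ : _ - _ = (a + c) ^+ 2 + (b + d) ^+ 2); last by ring.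
by rewrite addr_ge0 ?sqr_ge0.
Qed.

Lemma cisD (x y : R) : cis (x + y) = cis x * cis y.
Proof.
apply/eqP; rewrite eq_complex /cis cosD sinD /= eqxx /=.
by apply/eqP; ring.
Qed.
Lemma cis0 : cis 0 = 1 :> C. Proof. by rewrite /cis cos0 sin0. Qed.
Lemma conj_cis (x : R) : Num.conj (cis x) = cis (- x).
Proof. by rewrite conjCE /cis cosN sinN. Qed.

(** Parallelogram law for u + iv and u - iv. Since the z j are complex, |u|^2 + |v|^2 need not equal
    |u + iv|^2, and both signs of the phase are averaged. *)
Lemma sqm_sum_cos_sin (J : finType) (z : J -> C) (x : J -> R) :
  sqm (\sum_j z j * (cos (x j))%:C) + sqm (\sum_j z j * (sin (x j))%:C) =
  (sqm (\sum_j z j * cis (x j)) + sqm (\sum_j z j * cis (- x j))) / 2.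
Proof.
set u := \sum_j z j * (cos _)%:C; set v := \sum_j z j * (sin _)%:C.
have -> : \sum_j z j * cis (x j) = u + (0 +i* 1) * v.
  rewrite mulr_sumr -big_split /=; apply: eq_bigr => j _.
  by apply/eqP; rewrite eq_complex /cis /=; case: (z j) => a b /=;
    apply/andP; split; apply/eqP; ring.
have -> : \sum_j z j * cis (- x j) = u - (0 +i* 1) * v.
  rewrite mulr_sumr -sumrB /=; apply: eq_bigr => j _.
  by apply/eqP; rewrite eq_complex /cis cosN sinN /=; case: (z j) => a b /=;
    apply/andP; split; apply/eqP; ring.
by case: u => a b; case: v => c d; rewrite /sqm /=; field.
Qed.
End ComplexLemmas.

Section MatrixLemmas.
Context {R : realType}.
Local Notation C := R[i].
Local Notation Re := (@complex.Re R).

Lemma trCM m n p (X : 'M[C]_(m, n)) (Y : 'M[C]_(n, p)) :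
  (X *m Y)^t* = Y^t* *m X^t*.
Proof. by rewrite trmx_mul map_mxM. Qed.

Lemma trCE m n (X : 'M[C]_(m, n)) i j : (X^t*) i j = Num.conj (X j i).
Proof. by rewrite !mxE. Qed.

Definition hs2 m n (X : 'M[C]_(m, n)) : R := \sum_i \sum_j sqm (X i j).

Lemma hs2_ge0 m n (X : 'M[C]_(m, n)) : 0 <= hs2 X.
Proof. by do 2!apply: sumr_ge0 => ? _; exact: sqm_ge0. Qed.

Lemma hs2E m n (X : 'M[C]_(m, n)) : hs2 X = Re (\tr (X^t* *m X)).
Proof.
rewrite /mxtrace complexRe_sum /hs2 exchange_big; apply: eq_bigr => j _.
rewrite mxE complexRe_sum; apply: eq_bigr => i _.
by rewrite trCE Re_conjM.
Qed.

Lemma hsnorm_sqr m n (X : 'M[C]_(m, n)) : hsnorm X ^+ 2 = hs2 X.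
Proof. by rewrite /hsnorm -hs2E sqr_sqrtr // hs2_ge0. Qed.

Lemma hs2_trC m n (X : 'M[C]_(m, n)) : hs2 (X^t*) = hs2 X.
Proof.
rewrite /hs2 exchange_big; apply: eq_bigr => i _; apply: eq_bigr => j _.
by rewrite trCE sqm_conj.
Qed.

Lemma unitary_trCl n (U : 'M[C]_n) : U \is unitarymx -> U^t* *m U = 1%:M.
Proof.
by move=> Uu; have := mulVmx (unitarymx_unit Uu); rewrite invmx_unitary.
Qed.

Lemma unitary_trCr n (U : 'M[C]_n) : U \is unitarymx -> U *m U^t* = 1%:M.
Proof. by move/unitarymxP. Qed.

Lemma hs2_unitaryl m n (U : 'M[C]_m) (X : 'M[C]_(m, n)) :
  U \is unitarymx -> hs2 (U *m X) = hs2 X.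
Proof.
move=> Uu; rewrite hs2E [RHS]hs2E trCM; congr (Re (\tr _)).
by rewrite -mulmxA (mulmxA (U^t*)) unitary_trCl // mul1mx.
Qed.

Lemma hs2_unitaryr m n (U : 'M[C]_n) (X : 'M[C]_(m, n)) :
  U \is unitarymx -> hs2 (X *m U) = hs2 X.
Proof.
move=> Uu; rewrite -(hs2_trC (X *m U)) trCM -(hs2_trC X); apply: hs2_unitaryl.
by rewrite trmxC_unitary.
Qed.

Lemma hs2B_le m n (X Y : 'M[C]_(m, n)) : hs2 (X - Y) <= 2 * hs2 X + 2 * hs2 Y.
Proof.
rewrite /hs2 !mulr_sumr -big_split /=; apply: ler_sum => i _.
rewrite !mulr_sumr -big_split /=; apply: ler_sum => j _.
by rewrite !mxE; exact: sqmB_le.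
Qed.

Lemma hs2_cV n (v : 'cV[C]_n) : hs2 v = \sum_i sqm (v i ord0).
Proof. by apply: eq_bigr => i _; rewrite big_ord1. Qed.

Lemma hs2Z m n (a : C) (X : 'M[C]_(m, n)) : hs2 (a *: X) = sqm a * hs2 X.
Proof.
rewrite /hs2 mulr_sumr; apply: eq_bigr => i _; rewrite mulr_sumr.
by apply: eq_bigr => j _; rewrite mxE sqmM.
Qed.

Let normc_sum (I : Type) (r : seq I) (f : I -> C) :
  normc (\sum_(i <- r) f i) <= \sum_(i <- r) normc (f i).
Proof.
elim: r => [|i r IH]; first by rewrite !big_nil Normc.normc0.
by rewrite !big_cons (le_trans (le_normcD _ _)) // lerD2l.
Qed.

Let normcE' (z : C) : normc z = Num.sqrt (sqm z). Proof. by case: z. Qed.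

(** The supremum in [opnorm] is an upper bound only once its set is known to be bounded; here every
    coordinate of a vector of the unit ball has modulus at most 1. *)
Lemma opnorm_ubound n (X : 'M[C]_n) :
  has_ubound [set hsnorm (X *m v) | v in [set v : 'cV[C]_n | hsnorm v <= 1]].
Proof.
exists (Num.sqrt (\sum_i (\sum_j normc (X i j)) ^+ 2)) => _ [v /= v1 <-].
have v2 : hs2 v <= 1.
  by rewrite -hsnorm_sqr expr_le1 // sqrtr_ge0.
have vj j : normc (v j ord0) <= 1.
  rewrite normcE' -[leRHS]sqrtr1 ler_wsqrtr // (le_trans _ v2) // hs2_cV.
  by rewrite (bigD1 j) //= lerDl sumr_ge0 // => i _; exact: sqm_ge0.
rewrite /hsnorm -hs2E ler_wsqrtr // hs2_cV; apply: ler_sum => i _.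
have -> : sqm ((X *m v) i ord0) = normc ((X *m v) i ord0) ^+ 2.
  by rewrite normcE' sqr_sqrtr // sqm_ge0.
have n0 (z : C) : 0 <= normc z by rewrite normcE' sqrtr_ge0.
rewrite ler_pXn2r ?nnegrE ?sumr_ge0 // mxE.
apply: (le_trans (normc_sum _ _)); apply: ler_sum => j _.
by rewrite Normc.normcM ler_piMr.
Qed.

Lemma opnorm_ge0 n (X : 'M[C]_n) : 0 <= opnorm X.
Proof.
apply: (@le_trans _ _ (hsnorm (X *m (0 : 'cV[C]_n)))); first exact: sqrtr_ge0.
apply: ub_le_sup; first exact: opnorm_ubound.
exists 0 => //=; rewrite /hsnorm mulmx0 mxtrace0 /= sqrtr0 //.
Qed.

Lemma hs2_opnorm n (X : 'M[C]_n) (v : 'cV[C]_n) :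
  hs2 (X *m v) <= opnorm X ^+ 2 * hs2 v.
Proof.
have [v0|v0] := eqVneq (hs2 v) 0.
  have -> : v = 0.
    apply/matrixP => i j; rewrite ord1 mxE.
    move: v0; rewrite hs2_cV => /eqP; rewrite psumr_eq0; last by move=> ? _; exact: sqm_ge0.
    move/allP/(_ i); rewrite mem_index_enum => /(_ isT) /=.
    case: (v i ord0) => a b; rewrite /sqm /= paddr_eq0 ?sqr_ge0 // !sqrf_eq0.
    by move=> /andP[/eqP -> /eqP ->].
  rewrite mulmx0 (_ : hs2 0 = 0) ?mulr0 // hs2_cV big1 // => i _.
  by rewrite mxE /sqm /= expr0n addr0.
have vp : 0 < hs2 v by rewrite lt_def v0 hs2_ge0.
pose a := (Num.sqrt (hs2 v))^-1.
have a2 : a ^+ 2 = (hs2 v)^-1 by rewrite exprVn sqr_sqrtr // ltW.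
have : hsnorm (X *m (a%:C *: v)) <= opnorm X.
  apply: ub_le_sup; first exact: opnorm_ubound.
  exists (a%:C *: v) => //=.
  rewrite -(@ler_pXn2r _ 2) ?nnegrE ?sqrtr_ge0 // hsnorm_sqr hs2Z sqm_realC a2.
  by rewrite mulVf // expr1n.
rewrite -(@ler_pXn2r _ 2) ?nnegrE ?sqrtr_ge0 ?opnorm_ge0 // hsnorm_sqr.
by rewrite -scalemxAr hs2Z sqm_realC a2 mulrC ler_pdivrMr.
Qed.

Definition dg n (f : 'I_n -> C) : 'M[C]_n := diag_mx (\row_i f i).

Lemma mul_dg n m (f : 'I_n -> C) (X : 'M[C]_(n, m)) i j :
  (dg f *m X) i j = f i * X i j.
Proof. by rewrite mul_diag_mx !mxE. Qed.

Lemma mulmx_dg n m (f : 'I_n -> C) (X : 'M[C]_(m, n)) i j :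
  (X *m dg f) i j = X i j * f j.
Proof. by rewrite mul_mx_diag !mxE. Qed.

Lemma trC_dg n (f : 'I_n -> C) : (dg f)^t* = dg (fun i => Num.conj (f i)).
Proof.
apply/matrixP => i j; rewrite !mxE eq_sym.
by case: eqVneq => [->|_]; rewrite ?mulr1n ?mulr0n ?conjC0.
Qed.

Lemma eq_dg n (f g : 'I_n -> C) : f =1 g -> dg f = dg g.
Proof. by move=> /funext ->. Qed.

Definition eigval n (X : 'M[C]_n) (i : 'I_n) : R := Re (spectral_diag X ord0 i).

Lemma mxfunE n (phi : R -> C) (X : 'M[C]_n) :
  mxfun phi X = (spectralmx X)^t* *m dg (fun i => phi (eigval X i)) *m spectralmx X.
Proof.
rewrite /mxfun (invmx_unitary (spectral_unitarymx X)).
have -> // : diag_mx (map_mx (fun z => phi (Re z)) (spectral_diag X)) =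
  dg (fun i => phi (eigval X i)).
by rewrite /dg; f_equal; apply/matrixP => i j; rewrite !mxE ord1.
Qed.

Lemma hermsymmx_trC n (X : 'M[C]_n) : (X \is hermsymmx) = (X == X^t*).
Proof. by rewrite is_hermitianmxE expr0 scale1r. Qed.

Lemma spectral_decomposition n (X : 'M[C]_n) : X \is hermsymmx ->
  X = (spectralmx X)^t* *m dg (fun i => (eigval X i)%:C) *m spectralmx X.
Proof.
move=> Xh; have /hermitian_normalmx/orthomx_spectralP XE := Xh.
have dE : dg (fun i => (eigval X i)%:C) = diag_mx (spectral_diag X).
  have /mxOverP Xr := hermitian_spectral_diag_real Xh.
  by rewrite /dg; f_equal; apply/matrixP => i j; rewrite !mxE ord1 /eigval RRe_real.
by rewrite dE -(invmx_unitary (spectral_unitarymx X)).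
Qed.

(** A Gibbs state is given in the eigenbasis of H, while [mxfun] uses the basis that [spectralmx]
    picks for the state itself. Two eigenbases differ only by mixing within eigenspaces, where phi
    acts as a scalar. *)
Lemma mxfun_unitary n (phi : R -> C) (P : 'M[C]_n) (d : 'I_n -> R) :
  P \is unitarymx ->
  mxfun phi (P^t* *m dg (fun i => (d i)%:C) *m P) =
  P^t* *m dg (fun i => phi (d i)) *m P.
Proof.
move=> Pu; set X := (X in mxfun _ X).
have Xh : X \is hermsymmx.
  rewrite hermsymmx_trC /X trCM trCM trmxCK trC_dg mulmxA.
  rewrite (@eq_dg _ (fun i => Num.conj (d i)%:C) (fun i => (d i)%:C)) // => i.
  exact: conjC_realC.
have XE := spectral_decomposition Xh; rewrite mxfunE.
set V := spectralmx X in XE *; have Vu : V \is unitarymx by exact: spectral_unitarymx.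
(* [V *m P^t*] intertwines the two diagonal forms of [X], hence also their images under [phi] *)
pose W := V *m P^t*.
have WE f : W *m dg f = V *m (P^t* *m dg f *m P) *m P^t*.
  by rewrite -(mulmxA V) -(mulmxA _ P) (unitary_trCr Pu) mulmx1 mulmxA.
have EW f : dg f *m W = V *m (V^t* *m dg f *m V) *m P^t*.
  have E : V *m (V^t* *m dg f *m V) = dg f *m V.
    by rewrite mulmxA (mulmxA V) (unitary_trCr Vu) mul1mx.
  by rewrite E /W mulmxA.
have eqW : W *m dg (fun i => (d i)%:C) = dg (fun i => (eigval X i)%:C) *m W.
  by rewrite WE EW -XE.
have eqphi : W *m dg (fun i => phi (d i)) = dg (fun i => phi (eigval X i)) *m W.
  (* Read entrywise, [eqW] says that W i j = 0 unless d j is the i-th eigenvalue of X; in either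
     case phi may be applied to both. *)
  apply/matrixP => i j; have := congr1 (fun M : 'M[C]_n => M i j) eqW.
  rewrite 2!mulmx_dg 2!mul_dg; case: (eqVneq (d j) (eigval X i)) => [->|ne].
    by move=> _; rewrite mulrC.
  move=> /eqP; rewrite mulrC -subr_eq0 -mulrBl mulf_eq0 => /orP[|/eqP ->].
    by rewrite subr_eq0 => /eqP/complexI/eqP; rewrite (negbTE ne).
  by rewrite mulr0 mul0r.
have back f : V^t* *m (W *m dg f) *m P = P^t* *m dg f *m P.
  by rewrite /W -(mulmxA V) (mulmxA (V^t*)) (unitary_trCl Vu) mul1mx.
have -> : V^t* *m dg (fun i => phi (eigval X i)) *m V =
    V^t* *m (dg (fun i => phi (eigval X i)) *m W) *m P.
  rewrite /W -!(mulmxA (V^t*)); congr (_ *m _).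
  by rewrite -(mulmxA _ (V *m _)) -(mulmxA V) (unitary_trCl Pu) mulmx1.
by rewrite -eqphi back.
Qed.
End MatrixLemmas.

(** * The filtered operator *)

Section Filter.
Context {R : realType}.
Local Notation C := R[i].
Local Notation Re := (@complex.Re R).
Local Notation Im := (@complex.Im R).
Local Notation mu := (@lebesgue_measure R).
Variable kappa : R.
Hypothesis kappa_gt0 : 0 < kappa.
Let kappa_neq0 : kappa != 0. Proof. by rewrite gt_eqF. Qed.

(* [filter_f kappa] is this multiple of the density of N(0, width^2) *)
Let width : R := (Num.sqrt 2 * kappa)^-1.
Let scale : R := Num.sqrt (kappa * Num.sqrt (2 / pi)) / normal_peak width.

Let sqrt2_gt0 : 0 < Num.sqrt 2 :> R. Proof. by rewrite sqrtr_gt0. Qed.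
Let width_gt0 : 0 < width. Proof. by rewrite invr_gt0 mulr_gt0. Qed.

Let width2 : width ^+ 2 = (2 * kappa ^+ 2)^-1.
Proof. by rewrite /width exprVn exprMn sqr_sqrtr. Qed.

Let filter_fE t : filter_f kappa t = scale * normal_pdf 0 width t.
Proof.
have pk : normal_peak width != 0 by rewrite gt_eqF // normal_peak_gt0 // gt_eqF.
rewrite /filter_f /scale normal_pdfE ?gt_eqF // /normal_fun width2 subr0 [LHS]mulrC.
rewrite [RHS]mulrA (divfK pk); congr (_ * expR _).
by field.
Qed.

(** Both sides are nonnegative, so their squares are compared. The value makes the square of
    [gaussian kappa] the density of N(0, kappa^2). *)
Let scaleE : (Num.sqrt (2 * pi))^-1 * scale = Num.sqrt (normal_peak kappa).
Proof.
have pp := pi_gt0 R.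
have w0 : 0 < normal_peak width by rewrite normal_peak_gt0 // gt_eqF.
have s0 : 0 <= scale by rewrite divr_ge0 ?sqrtr_ge0 // ltW.
have k0 : 0 <= normal_peak kappa by exact: normal_peak_ge0.
apply/eqP; rewrite -(@eqrXn2 _ 2) ?mulr_ge0 ?invr_ge0 ?sqrtr_ge0 //; apply/eqP.
rewrite exprMn exprVn sqr_sqrtr; last by rewrite mulr_ge0 // ltW.
rewrite sqr_sqrtr // /scale expr_div_n sqr_sqrtr; last first.
  by rewrite mulr_ge0 ?sqrtr_ge0 // ltW.
rewrite /normal_peak exprVn sqr_sqrtr; last first.
  by rewrite mulrn_wge0 // mulr_ge0 ?sqr_ge0 // ltW.
rewrite width2.
set S := Num.sqrt (2 / @pi R); set Q := Num.sqrt (kappa ^+ 2 * @pi R *+ 2).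
have SQ : S * Q = 2 * kappa.
  rewrite /S /Q -sqrtrM; last by rewrite divr_ge0 // ltW.
  rewrite (_ : 2 / pi * (kappa ^+ 2 * pi *+ 2) = (2 * kappa) ^+ 2).
    by rewrite sqrtr_sqr ger0_norm // mulr_ge0 // ltW.
  by move: (pi) pp => P P0; field; rewrite gt_eqF.
have Q0 : Q != 0.
  by rewrite gt_eqF // sqrtr_gt0 mulrn_wgt0 // mulr_gt0 // exprn_gt0.
rewrite (_ : S = 2 * kappa / Q); last by rewrite -SQ mulfK.
by move: (pi) pp => P P0; field; rewrite kappa_neq0 Q0 gt_eqF.
Qed.

Let integrable_filter_trig (x th : R) :
  mu.-integrable setT (EFin \o (fun t => filter_f kappa t * cos (x * t + th))).
Proof.
have i1 : mu.-integrable setT (EFin \o (fun t => normal_pdf 0 width t * cos (x * t + th))).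
  apply: integrable_normal_pdf_bounded => //; last first.
    by move=> t; rewrite ler_norml cos_geN1 cos_le1.
  apply: continuous_measurable_fun => t.
  apply: (@continuous_comp _ _ _ (fun t => x * t + th) (@cos R));
    last exact: continuous_cos.
  by apply: cvgD; [apply: cvgMl_tmp; exact: cvg_id|exact: cvg_cst].
rewrite (_ : _ \o _ = fun t => (scale%:E * (normal_pdf 0 width t * cos (x * t + th))%:E)%E).
  by apply: integrableZl => //; exact: i1.
by apply/funext => t /=; rewrite filter_fE -mulrA.
Qed.

Let integral_filter_trig (x th : R) :
  \int[mu]_t (filter_f kappa t * cos (x * t + th)) =
  scale * (cos th * expR (- (x ^+ 2 / (4 * kappa ^+ 2)))).
Proof.
under eq_Rintegral do rewrite filter_fE -mulrA.
rewrite RintegralZl //; last first.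
  apply: integrable_normal_pdf_bounded => //; last first.
    by move=> t; rewrite ler_norml cos_geN1 cos_le1.
  apply: continuous_measurable_fun => t.
  apply: (@continuous_comp _ _ _ (fun t => x * t + th) (@cos R));
    last exact: continuous_cos.
  by apply: cvgD; [apply: cvgMl_tmp; exact: cvg_id|exact: cvg_cst].
rewrite Rintegral_normal_pdf_cos // width2; congr (_ * (_ * expR _)).
by field.
Qed.

(** Real and imaginary parts are real combinations of f(t) cos(x_j t) and f(t) sin(x_j t). The
    boolean index marks the sines, written as cosines of phase - pi/2, and their integrals
    vanish. *)
Lemma integral_filter_sum (J : finType) (g : J -> C) (x : J -> R) :
  ((Num.sqrt (2 * pi))^-1)%:C *
  (\int[mu]_t Re ((filter_f kappa t)%:C * \sum_j g j * cis (x j * t)) +i*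
   \int[mu]_t Im ((filter_f kappa t)%:C * \sum_j g j * cis (x j * t))) =
  \sum_j g j * (gaussian kappa (x j))%:C.
Proof.
pose I := (J * bool)%type.
pose th (p : I) : R := if p.2 then - (pi / 2) else 0.
pose fn (p : I) t := filter_f kappa t * cos (x p.1 * t + th p).
have ifn p : mu.-integrable setT (EFin \o fn p) by exact: integrable_filter_trig.
have cosT y : cos (y - pi / 2) = sin y.
  by rewrite cosB cos_pihalf sin_pihalf mulr0 mulr1 add0r.
have thI (f : I -> R) : \sum_p f p = \sum_j (f (j, true) + f (j, false)).
  transitivity (\sum_p f (p.1, p.2)); first by apply: eq_bigr => -[].
  rewrite -(pair_bigA _ (fun j b => f (j, b))) /=; apply: eq_bigr => j _.
  by rewrite big_bool.
pose coR (p : I) := if p.2 then - Im (g p.1) else Re (g p.1).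
pose coI (p : I) := if p.2 then Re (g p.1) else Im (g p.1).
have ReE t : Re ((filter_f kappa t)%:C * \sum_j g j * cis (x j * t)) =
    \sum_p coR p * fn p t.
  rewrite complexReZ complexRe_sum thI mulr_sumr; apply: eq_bigr => j _.
  by rewrite complexReM /coR /fn /th /= addr0 cosT; ring.
have ImE t : Im ((filter_f kappa t)%:C * \sum_j g j * cis (x j * t)) =
    \sum_p coI p * fn p t.
  rewrite complexImZ complexIm_sum thI mulr_sumr; apply: eq_bigr => j _.
  by rewrite complexImM /coI /fn /th /= addr0 cosT; ring.
have [_ IR] := integrable_lincomb (index_enum I) coR ifn.
have [_ II] := integrable_lincomb (index_enum I) coI ifn.
under eq_Rintegral do rewrite ReE.
under [X in _ +i* X]eq_Rintegral do rewrite ImE.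
rewrite IR II !thI.
have gT j : \int[mu]_t fn (j, true) t = 0.
  by rewrite integral_filter_trig /th /= cosN cos_pihalf mul0r mulr0.
have gF j : \int[mu]_t fn (j, false) t = scale * expR (- (x j ^+ 2 / (4 * kappa ^+ 2))).
  by rewrite integral_filter_trig /th /= cos0 mul1r.
apply/eqP; rewrite eq_complex complexReZ complexImZ complexRe_sum complexIm_sum /=; apply/andP; split; apply/eqP;
  rewrite mulr_sumr; apply: eq_bigr => j _; rewrite gT gF /coR /coI /=;
  rewrite mulr0 add0r ?complexReM ?complexImM /= mulr0 ?subr0 ?add0r /gaussian -scaleE; ring.
Qed.

(** In the energy basis, entry (a, b) of the evolved operator oscillates at the single frequency E a
    - E b, so filtering multiplies it by one value of the Fourier transform of f. *)
Lemma Ahat_spectral n (H A W : 'M[C]_n) (E : 'I_n -> R) (omega : R) :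
  (forall t, evol H t = W^t* *m dg (fun a => cis (E a * t)) *m W) ->
  W \is unitarymx ->
  Ahat kappa H A omega = W^t* *m (\matrix_(a, b) ((W *m A *m W^t*) a b *
     (gaussian kappa (omega - (E a - E b)))%:C)) *m W.
Proof.
move=> Ht Wu.
have sandwich (M : 'M[C]_n) i j : (W^t* *m M *m W) i j =
    \sum_(p : 'I_n * 'I_n) (W^t*) i p.1 * M p.1 p.2 * W p.2 j.
  rewrite -(pair_bigA _ (fun a b => (W^t*) i a * M a b * W b j)) /=.
  rewrite exchange_big mxE; apply: eq_bigr => b _.
  by rewrite [(_ *m _) i b]mxE mulr_suml.
have evA t : evol H t *m A *m evol H (- t) =
    W^t* *m (\matrix_(a, b) ((W *m A *m W^t*) a b * cis ((E a - E b) * t))) *m W.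
  rewrite !Ht.
  have -> : (\matrix_(a, b) ((W *m A *m W^t*) a b * cis ((E a - E b) * t))) =
      dg (fun a => cis (E a * t)) *m (W *m A *m W^t*) *m dg (fun a => cis (E a * - t)).
    apply/matrixP => a b; rewrite mulmx_dg mul_dg mxE mulrBl cisD mulrN; ring.
  by move: (dg _) (dg _) (W^t*) => D D' V; rewrite !mulmxA.
apply/matrixP => i j; rewrite sandwich /Ahat [LHS]mxE [mxintegral _ i j]mxE.
pose g (p : 'I_n * 'I_n) := (W^t*) i p.1 * (W *m A *m W^t*) p.1 p.2 * W p.2 j.
pose x (p : 'I_n * 'I_n) := (E p.1 - E p.2) - omega.
have ent t : ((cis (- (omega * t)) * (filter_f kappa t)%:C) *:
    (evol H t *m A *m evol H (- t))) i j =
    (filter_f kappa t)%:C * \sum_p g p * cis (x p * t).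
  rewrite mxE evA sandwich mulrAC mulrC mulrA -mulrA; congr (_ * _).
  rewrite mulrC mulr_suml; apply: eq_bigr => p _.
  rewrite [(\matrix_(_, _) _) _ _]mxE /g /x [(_ - omega) * t]mulrBl cisD; ring.
under eq_Rintegral do rewrite ent.
under [X in _ +i* X]eq_Rintegral do rewrite ent.
rewrite integral_filter_sum; apply: eq_bigr => p _.
rewrite [(\matrix_(_, _) _) _ _]mxE /g /x /gaussian -(sqrrN (_ - omega)) opprB; ring.
Qed.
End Filter.

(** * States and Gibbs states *)

Section UnitaryConjugation.
Context {R : realType}.
Local Notation C := R[i].
Local Notation Re := (@complex.Re R).
Variable n : nat.
Implicit Types M X Y U W P : 'M[C]_n.

Lemma unitary_conjM P M1 M2 : P \is unitarymx ->
  (P^t* *m M1 *m P) *m (P^t* *m M2 *m P) = P^t* *m (M1 *m M2) *m P.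
Proof.
move=> Pu; have := unitary_trCr Pu; move: (P^t*) => Q PQ.
by rewrite !mulmxA -(mulmxA _ P Q) PQ mulmx1.
Qed.

Lemma dgM (f g : 'I_n -> C) : dg f *m dg g = dg (fun i => f i * g i).
Proof.
apply/matrixP => i j; rewrite mul_dg !mxE.
by case: eqVneq => [->|_]; rewrite ?mulr1n ?mulr0n ?mulr0.
Qed.

Lemma mxtrace_unitary P M : P \is unitarymx -> \tr (P^t* *m M *m P) = \tr M.
Proof.
move=> Pu; rewrite mxtrace_mulC mulmxA (unitary_trCr Pu) mul1mx //.
Qed.

Lemma Re_tr_weighted (f g : 'I_n -> R) Y :
  Re (\tr (Y^t* *m dg (fun i => (f i)%:C) *m Y *m dg (fun j => (g j)%:C))) =
  \sum_i \sum_j f i * g j * sqm (Y i j).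
Proof.
rewrite exchange_big /mxtrace complexRe_sum; apply: eq_bigr => j _.
rewrite mulmx_dg [(_ *m Y) j j]mxE mulr_suml complexRe_sum; apply: eq_bigr => i _.
rewrite mulmx_dg trCE -Re_conjM.
rewrite (_ : _ * _ * _ * _ = (f i * g j)%:C * (Num.conj (Y i j) * Y i j)) ?complexReZ //.
by rewrite rmorphM; ring.
Qed.

Lemma mulmx_sandwichE (T M : 'M[C]_n) i j : (T *m M *m T^t*) i j =
  \sum_(p : 'I_n * 'I_n) T i p.1 * M p.1 p.2 * Num.conj (T j p.2).
Proof.
rewrite -(pair_bigA _ (fun a b => T i a * M a b * Num.conj (T j b))) /=.
rewrite exchange_big mxE; apply: eq_bigr => b _.
by rewrite [(_ *m _) i b]mxE mulr_suml trCE.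
Qed.

Lemma change_basis U W M :
  U *m (W^t* *m M *m W) *m U^t* = (U *m W^t*) *m M *m (U *m W^t*)^t*.
Proof.
rewrite trCM trmxCK; move: (W^t*) (U^t*) => Q V.
by rewrite !mulmxA.
Qed.

Lemma hs2_unitary_conj U X : U \is unitarymx -> hs2 (U *m X *m U^t*) = hs2 X.
Proof.
by move=> Uu; rewrite hs2_unitaryr ?trmxC_unitary // hs2_unitaryl.
Qed.

Lemma unitary_conjK U X : U \is unitarymx -> X = U^t* *m (U *m X *m U^t*) *m U.
Proof.
move=> Uu; have := unitary_trCl Uu; move: (U^t*) => V VU.
by rewrite !mulmxA VU mul1mx -mulmxA VU mulmx1.
Qed.

(* Weighted AM-GM bounds the weight of the entry (i, j) by (1/2 + s) e^{x_i} + (1/2 - s) e^{x_j}. *)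
Lemma sum_interpolated_weights_le U X (x : 'I_n -> R) (s B : R) :
  U \is unitarymx -> X^t* = - X ->
  (forall v : 'cV[C]_n, hs2 (X *m v) <= B * hs2 v) ->
  \sum_i expR (x i) = 1 -> - 2^-1 <= s <= 2^-1 ->
  \sum_i \sum_j expR ((x i + x j) / 2) * expR (s * (x i - x j)) *
    sqm ((U *m X *m U^t*) i j) <= B.
Proof.
move=> Uu Xskew HB sx /andP[s1 s2].
set Y := U *m X *m U^t*.
have Yc j : \sum_i sqm (Y i j) <= B.
  pose e : 'cV[C]_n := delta_mx j 0.
  have -> : \sum_i sqm (Y i j) = hs2 (Y *m e).
    by rewrite hs2_cV; apply: eq_bigr => i _; rewrite /e -colE [(col j Y) i _]mxE.
  have -> : Y *m e = U *m (X *m (U^t* *m e)) by rewrite /Y !mulmxA.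
  rewrite hs2_unitaryl //; apply: le_trans (HB _) _.
  rewrite hs2_unitaryl ?trmxC_unitary // (_ : hs2 e = 1) ?mulr1 //.
  rewrite hs2_cV (bigD1 j) //= big1 => [|i ij]; rewrite /e mxE ?eqxx /=.
    by rewrite addr0 /sqm /= expr1n expr0n addr0.
  by rewrite (negbTE ij) /sqm /= expr0n addr0.
have Ysk : Y^t* = - Y.
  by rewrite /Y trCM trCM trmxCK Xskew mulNmx mulmxN mulmxA.
(* The bound on columns passes to rows because Y is skew-Hermitian. *)
have Yr i : \sum_j sqm (Y i j) <= B.
  rewrite (eq_bigr (fun j => sqm (Y j i))) // => j _.
  have h : (- Y) i j = Num.conj (Y j i) by rewrite -trCE Ysk.
  have N : (- Y) i j = - (Y i j) by rewrite [LHS]mxE.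
  by rewrite -[LHS]sqmN -N h sqm_conj.
have wle i j : expR ((x i + x j) / 2) * expR (s * (x i - x j)) <=
    (2^-1 + s) * expR (x i) + (2^-1 - s) * expR (x j).
  rewrite -expRD; set m := (x i + x j) / 2 + s * (x i - x j).
  (* Tangent line of exp at m = (1/2 + s) x_i + (1/2 - s) x_j; the linear terms cancel in the
     average with weights 1/2 + s and 1/2 - s. *)
  have e (y : R) : expR m * (1 + (y - m)) <= expR y.
    rewrite -[leRHS](_ : expR m * expR (y - m) = _); last by rewrite -expRD subrKC.
    by rewrite ler_wpM2l ?expR_ge0 // expR_ge1Dx.
  have h1 : (2^-1 + s) * (expR m * (1 + (x i - m))) <= (2^-1 + s) * expR (x i).
    by rewrite ler_wpM2l //; lra.
  have h2 : (2^-1 - s) * (expR m * (1 + (x j - m))) <= (2^-1 - s) * expR (x j).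
    by rewrite ler_wpM2l //; lra.
  apply: le_trans (lerD h1 h2); rewrite le_eqVlt; apply/orP; left; apply/eqP.
  by rewrite /m; field.
apply: (@le_trans _ _ (\sum_i \sum_j ((2^-1 + s) * expR (x i) * sqm (Y i j) +
    (2^-1 - s) * expR (x j) * sqm (Y i j)))).
  apply: ler_sum => i _; apply: ler_sum => j _.
  by rewrite -mulrDl ler_wpM2r ?sqm_ge0.
have -> : \sum_i \sum_j ((2^-1 + s) * expR (x i) * sqm (Y i j) +
    (2^-1 - s) * expR (x j) * sqm (Y i j)) =
    (2^-1 + s) * (\sum_i expR (x i) * \sum_j sqm (Y i j)) +
    (2^-1 - s) * (\sum_j expR (x j) * \sum_i sqm (Y i j)).
  under eq_bigr do rewrite big_split /=.
  rewrite big_split /= [X in _ + X]exchange_big /= !mulr_sumr; congr (_ + _);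
    by apply: eq_bigr => i _; rewrite -mulr_sumr mulrA.
have L (f : 'I_n -> R) : (forall i, f i <= B) -> \sum_i expR (x i) * f i <= B.
  move=> fB; rewrite -[leRHS]mul1r -sx mulr_suml; apply: ler_sum => i _.
  by rewrite ler_wpM2l ?expR_ge0.
rewrite -[leRHS](_ : (2^-1 + s) * B + (2^-1 - s) * B = B); last by field.
by apply: lerD; apply: ler_wpM2l; [lra|exact: L|lra|exact: L].
Qed.

Lemma hs2_commutator_le X Y (v : 'cV[C]_n) :
  hs2 (commutator X Y *m v) <= 4 * (opnorm X ^+ 2 * opnorm Y ^+ 2) * hs2 v.
Proof.
rewrite /commutator mulmxBl; apply: le_trans (hs2B_le _ _) _.
rewrite -!mulmxA.
have h1 : hs2 (X *m (Y *m v)) <= opnorm X ^+ 2 * (opnorm Y ^+ 2 * hs2 v).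
  by apply: le_trans (hs2_opnorm _ _) _; rewrite ler_wpM2l ?sqr_ge0 ?hs2_opnorm.
have h2 : hs2 (Y *m (X *m v)) <= opnorm Y ^+ 2 * (opnorm X ^+ 2 * hs2 v).
  by apply: le_trans (hs2_opnorm _ _) _; rewrite ler_wpM2l ?sqr_ge0 ?hs2_opnorm.
have key (a b c : R) : 2 * (a * (b * c)) + 2 * (b * (a * c)) = 4 * (a * b) * c.
  by ring.
rewrite -(key (opnorm X ^+ 2) (opnorm Y ^+ 2) (hs2 v)).
exact: (lerD (ler_wpM2l (ler0n R 2) h1) (ler_wpM2l (ler0n R 2) h2)).
Qed.

Lemma opnorm_unitary_conj U X : U \is unitarymx ->
  opnorm (U *m X *m U^t*) <= opnorm X.
Proof.
move=> Uu; apply: ge_sup.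
  by exists (hsnorm ((U *m X *m U^t*) *m (0 : 'cV[C]_n))), 0 => //=;
    rewrite /hsnorm mulmx0 mxtrace0 /= sqrtr0 ler01.
move=> _ [v /= v1 <-].
rewrite -(@ler_pXn2r _ 2) ?nnegrE ?sqrtr_ge0 ?opnorm_ge0 // hsnorm_sqr.
rewrite -!mulmxA hs2_unitaryl //; apply: le_trans (hs2_opnorm _ _) _.
rewrite hs2_unitaryl ?trmxC_unitary // -hsnorm_sqr ler_piMr ?sqr_ge0 //.
by rewrite expr_le1 // sqrtr_ge0.
Qed.
End UnitaryConjugation.

Section State.
Context {R : realType}.
Local Notation C := R[i].
Local Notation Re := (@complex.Re R).
Variables (n : nat) (sigma : 'M[C]_n).
Hypothesis sigma_state : full_rank_state sigma.
Local Notation U := (spectralmx sigma).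
Local Notation p := (eigval sigma).

Let Uu : U \is unitarymx. Proof. exact: spectral_unitarymx. Qed.

Let sigmaE : sigma = U^t* *m dg (fun i => (p i)%:C) *m U.
Proof. by have [[sh _ _] _] := sigma_state; exact: spectral_decomposition. Qed.

Lemma state_eigval_sum : \sum_i p i = 1.
Proof.
have [[_ _ tr1] _] := sigma_state.
move: tr1; rewrite {1}sigmaE mxtrace_unitary // mxtrace_diag => /(congr1 Re).
rewrite complexRe_sum => h; apply: etrans h; apply: eq_bigr => i _.
by rewrite mxE.
Qed.

(** Positivity of the form at the i-th eigenvector gives p i >= 0; a zero eigenvalue would make the
    determinant vanish, against full rank. *)
Lemma state_eigval_gt0 i : 0 < p i.
Proof.
have [[_ psd _] rk] := sigma_state.
have USU : U *m sigma *m U^t* = dg (fun i => (p i)%:C).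
  have key (A Q S : 'M[C]_n) : A *m Q = 1%:M -> A *m (Q *m S *m A) *m Q = S.
    by move=> AQ; rewrite !mulmxA AQ mul1mx -mulmxA AQ mulmx1.
  apply: etrans (key U (U^t*) _ (unitary_trCr Uu)).
  by rewrite -sigmaE.
have p0 : 0 <= p i.
  pose e : 'cV[C]_n := delta_mx i 0.
  have := psd (U^t* *m e).
  have -> : (U^t* *m e)^t* *m sigma *m (U^t* *m e) = e^t* *m (U *m sigma *m U^t*) *m e.
    rewrite trCM trmxCK; move: (U^t*) (e^t*) => Q f.
    by rewrite !mulmxA.
  rewrite USU mxE (bigD1 i) //= big1 ?addr0; last first.
    by move=> j ji; rewrite /e !mxE (negbTE ji) mulr0.
  rewrite mulmx_dg !mxE !eqxx /= conjC1 mul1r mulr1.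
  by rewrite lecR.
rewrite lt_def p0 andbT; apply/eqP => pi0.
have : sigma \in unitmx by rewrite -row_free_unit /row_free rk.
rewrite unitmxE {1}sigmaE !det_mulmx det_diag (bigD1 i) //= mxE pi0.
by rewrite mul0r mulr0 mul0r unitr0.
Qed.

Lemma mxpow_stateE r : mxpow sigma r =
  U^t* *m dg (fun i => (expR (r * ln (p i)))%:C) *m U.
Proof.
rewrite /mxpow mxfunE (@eq_dg _ _ _ (fun i => (expR (r * ln (p i)))%:C)) // => i.
by rewrite /powR gt_eqF // state_eigval_gt0.
Qed.

Lemma mxln_stateE : mxln sigma = U^t* *m dg (fun i => (ln (p i))%:C) *m U.
Proof. exact: mxfunE. Qed.

Lemma expR_ln_state_sum : \sum_i expR (ln (p i)) = 1.
Proof.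
rewrite -state_eigval_sum; apply: eq_bigr => i _.
by rewrite lnK // posrE state_eigval_gt0.
Qed.
End State.

Section Gibbs.
Context {R : realType}.
Local Notation C := R[i].
Variables (n : nat) (beta : R) (H : 'M[C]_n).
Local Notation W := (spectralmx H).
Local Notation E := (eigval H).

Let Wu : W \is unitarymx. Proof. exact: spectral_unitarymx. Qed.
Definition partition_sum : R := \sum_a expR (- beta * E a).
Local Notation z := partition_sum.
(** The sum is empty for n = 0, so an index has to be supplied. *)
Let z_gt0 (a : 'I_n) : 0 < z.
Proof.
by rewrite /partition_sum (bigD1 a) //= ltr_wpDr ?expR_gt0 // sumr_ge0.
Qed.

Let gibbsE : gibbs beta H = W^t* *m dg (fun a => (expR (- beta * E a) / z)%:C) *m W.
Proof.
rewrite /gibbs mxfunE mxtrace_unitary // mxtrace_diag.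
have -> : \sum_i (\row_i0 (expR (- beta * E i0))%:C) 0 i = z%:C :> C.
  by rewrite /partition_sum rmorph_sum; apply: eq_bigr => a _; rewrite mxE.
have -> : dg (fun a => (expR (- beta * E a) / z)%:C) =
    z%:C^-1 *: dg (fun a => (expR (- beta * E a))%:C).
  apply/matrixP => a b; rewrite !mxE mulrnAr; congr (_ *+ _).
  by rewrite mulrC rmorphM fmorphV.
by rewrite -scalemxAr -scalemxAl.
Qed.

Lemma mxln_gibbsE : mxln (gibbs beta H) =
  W^t* *m dg (fun a => (- beta * E a - ln z)%:C) *m W.
Proof.
apply: etrans (etrans (congr1 _ gibbsE) (mxfun_unitary _ _ Wu)) _.
rewrite (@eq_dg _ _ _ (fun a => (- beta * E a - ln z)%:C)) // => a.
have z0 := z_gt0 a.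
by rewrite ln_div ?posrE ?expR_gt0 // expRK.
Qed.

Lemma mxpow_gibbsE r : mxpow (gibbs beta H) r =
  W^t* *m dg (fun a => (expR (r * (- beta * E a - ln z)))%:C) *m W.
Proof.
apply: etrans (etrans (congr1 _ gibbsE) (mxfun_unitary _ _ Wu)) _.
rewrite (@eq_dg _ _ _ (fun a => (expR (r * (- beta * E a - ln z)))%:C)) // => a.
have z0 := z_gt0 a.
by rewrite /powR gt_eqF ?divr_gt0 ?expR_gt0 // ln_div ?posrE ?expR_gt0 // expRK.
Qed.

Lemma evolE t : evol H t = W^t* *m dg (fun a => cis (E a * t)) *m W.
Proof. exact: mxfunE. Qed.
End Gibbs.

(** * Entries in the eigenbases *)

Section Model.
Context {R : realType}.
Local Notation C := R[i].
Local Notation Re := (@complex.Re R).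
Local Notation Im := (@complex.Im R).
Variables (n : nat) (beta kappa : R) (H A sigma : 'M[C]_n).
Hypotheses (beta_gt0 : 0 < beta) (kappa_gt0 : 0 < kappa).
Hypothesis A_herm : A \is hermsymmx.
Hypothesis sigma_state : full_rank_state sigma.
Local Notation U := (spectralmx sigma).
Local Notation W := (spectralmx H).
Local Notation E := (eigval H).

Let x (i : 'I_n) : R := ln (eigval sigma i).
Let Uu : U \is unitarymx. Proof. exact: spectral_unitarymx. Qed.
Let Wu : W \is unitarymx. Proof. exact: spectral_unitarymx. Qed.
Let T := U *m W^t*.
Let A' := W *m A *m W^t*.

Definition bohr (p : 'I_n * 'I_n) : R := E p.1 - E p.2.

(* Entry [ij], in the eigenbasis of [sigma], of the part of [e^{iHt} A e^{-iHt}] of Bohr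
   frequency [bohr p].  Indices [(ij, b)] list imaginary ([b = true]) and real parts. *)
Definition mode (ij : 'I_n * 'I_n) (p : 'I_n * 'I_n) (t : R) : C :=
  T ij.1 p.1 * A' p.1 p.2 * Num.conj (T ij.2 p.2) * cis (bohr p * t).

Definition mode_part (k : 'I_n * 'I_n * bool) (p : 'I_n * 'I_n) (t : R) : R :=
  if k.2 then Im (mode k.1 p t) else Re (mode k.1 p t).

Definition mode_weight (k : 'I_n * 'I_n * bool) : R := expR ((x k.1.1 + x k.1.2) / 2).

Definition mode_gap (k : 'I_n * 'I_n * bool) : R := x k.1.1 - x k.1.2.

Let th (ij p : 'I_n * 'I_n) : R := x ij.1 - x ij.2 + beta * bohr p.

(** The factors r are real, so they act separately on real and imaginary parts, and the two squares
    of each entry add up to a squared modulus. *)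
Lemma sum_mode_part (a : 'I_n * 'I_n -> R) (r : 'I_n * 'I_n -> 'I_n * 'I_n -> R) t :
  \sum_k a k.1 * (\sum_p mode_part k p t * r k.1 p) ^+ 2 =
  \sum_i \sum_j a (i, j) * sqm (\sum_p mode (i, j) p t * (r (i, j) p)%:C).
Proof.
transitivity (\sum_(k : 'I_n * 'I_n * bool) a k.1 *
  (\sum_p mode_part (k.1, k.2) p t * r k.1 p) ^+ 2); first by apply: eq_bigr => -[].
rewrite -(pair_bigA _ (fun ij b => a ij * (\sum_p mode_part (ij, b) p t * r ij p) ^+ 2)) /=.
rewrite [RHS](pair_bigA _ (fun i j => a (i, j) * sqm (\sum_p mode (i, j) p t * (r (i, j) p)%:C))) /=.
apply: eq_bigr => -[i j] _ /=.
rewrite big_bool /= -mulrDr addrC /sqm complexRe_sum complexIm_sum.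
congr (_ * (_ ^+ 2 + _ ^+ 2)); apply: eq_bigr => p _; rewrite /mode_part /=.
  by rewrite mulrC -complexReZ mulrC.
by rewrite mulrC -complexImZ mulrC.
Qed.

Local Notation K0 := (mxln sigma - mxln (gibbs beta H)).

Let mxBE (X Y : 'M[C]_n) i j : (X - Y) i j = X i j - Y i j.
Proof. by rewrite !mxE. Qed.

Let basis_r (P Q B X : 'M[C]_n) : P *m Q = 1%:M ->
  P *m (B *m (Q *m X *m P)) *m Q = (P *m B *m Q) *m X.
Proof.
by move=> PQ; rewrite !mulmxA -(mulmxA _ P Q) PQ mulmx1.
Qed.

Let basis_l (P Q B X : 'M[C]_n) : P *m Q = 1%:M ->
  P *m ((Q *m X *m P) *m B) *m Q = X *m (P *m B *m Q).
Proof. by move=> PQ; rewrite !mulmxA PQ mul1mx. Qed.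

Let sub4_entry (X1 X2 X3 X4 : 'M[C]_n) i j (a1 a2 a3 a4 : C) :
  X1 i j = a1 -> X2 i j = a2 -> X3 i j = a3 -> X4 i j = a4 ->
  ((X1 - X2) - (X3 - X4)) i j = (a1 - a2) - (a3 - a4).
Proof. by move=> <- <- <- <-; rewrite !mxBE. Qed.

Let conj_commutator (P Q B ls lr : 'M[C]_n) : P *m commutator B (ls - lr) *m Q =
    (P *m (B *m ls) *m Q - P *m (B *m lr) *m Q) -
    (P *m (ls *m B) *m Q - P *m (lr *m B) *m Q).
Proof. by rewrite /commutator !(mulmxBr, mulmxBl). Qed.

Let gibbs_log (a : 'I_n) : R := - beta * E a - ln (partition_sum beta H).

Let entry_ls (M : 'M[C]_n) i j :
  (U *m ((W^t* *m M *m W) *m mxln sigma) *m U^t*) i j =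
  (T *m M *m T^t*) i j * (x j)%:C.
Proof.
by rewrite mxln_stateE (basis_r _ _ (unitary_trCr Uu)) change_basis mulmx_dg.
Qed.

Let entry_sl (M : 'M[C]_n) i j :
  (U *m (mxln sigma *m (W^t* *m M *m W)) *m U^t*) i j =
  (x i)%:C * (T *m M *m T^t*) i j.
Proof.
by rewrite mxln_stateE (basis_l _ _ (unitary_trCr Uu)) change_basis mul_dg.
Qed.

Let entry_lr (M : 'M[C]_n) i j :
  (U *m ((W^t* *m M *m W) *m mxln (gibbs beta H)) *m U^t*) i j =
  \sum_p T i p.1 * (M p.1 p.2 * (gibbs_log p.2)%:C) * Num.conj (T j p.2).
Proof.
rewrite mxln_gibbsE (unitary_conjM _ _ Wu) change_basis mulmx_sandwichE.
by apply: eq_bigr => p _; rewrite mulmx_dg.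
Qed.

Let entry_rl (M : 'M[C]_n) i j :
  (U *m (mxln (gibbs beta H) *m (W^t* *m M *m W)) *m U^t*) i j =
  \sum_p T i p.1 * ((gibbs_log p.1)%:C * M p.1 p.2) * Num.conj (T j p.2).
Proof.
rewrite mxln_gibbsE (unitary_conjM _ _ Wu) change_basis mulmx_sandwichE.
by apply: eq_bigr => p _; rewrite mul_dg.
Qed.

(** The outer indices diagonalize log sigma and the inner pair diagonalizes log rho; the constant ln
    z of log rho cancels between its two positions. *)
Lemma commutator_entry (M : 'M[C]_n) i j :
  (U *m commutator (W^t* *m M *m W) K0 *m U^t*) i j =
  - \sum_p T i p.1 * M p.1 p.2 * Num.conj (T j p.2) * (th (i, j) p)%:C.
Proof.
apply: etrans (congr1 (fun N : 'M[C]_n => N i j) (conj_commutator _ _ _ _ _)) _.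
apply: etrans (sub4_entry (entry_ls M i j) (entry_lr M i j) (entry_sl M i j) (entry_rl M i j)) _.
rewrite mulmx_sandwichE mulr_suml mulr_sumr -!sumrB -sumrN; apply: eq_bigr => p _.
have -> : th (i, j) p = (x i - x j) + (gibbs_log p.2 - gibbs_log p.1).
  by rewrite /th /bohr /gibbs_log /=; ring.
move: (T i p.1) (M p.1 p.2) (Num.conj _) (gibbs_log p.1) (gibbs_log p.2) (x i) (x j).
move=> a b c l1 l2 xi xj; rewrite rmorphD !rmorphB; ring.
Qed.

Lemma Ahat_tE (w t : R) : Ahat_t kappa H A w t = W^t* *m
  (\matrix_(a, b) (A' a b * (gaussian kappa (w - (E a - E b)))%:C * cis ((E a - E b) * t))) *m W.
Proof.
rewrite /Ahat_t (@Ahat_spectral _ _ kappa_gt0 _ H A W E w (evolE H) Wu) !evolE.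
rewrite !(unitary_conjM _ _ Wu); congr (_ *m _ *m _).
apply/matrixP => a b; rewrite mulmx_dg mul_dg [LHS]mulrAC.
rewrite [(\matrix_(_, _) _) _ _]mxE [RHS]mxE mulrBl cisD -mulrN.
by move: (A' _ _) (cis _) (cis _) (_%:C) => u v y z; ring.
Qed.

Let realCM (a b : R) : (a * b)%:C = a%:C * b%:C :> C.
Proof. exact: rmorphM. Qed.

Let entry_ring2 (a b c d g h : C) : a * (b * g * d) * c * h = a * b * c * d * (h * g).
Proof. by ring. Qed.

Lemma fisher_link (s w t : R) :
  sqnorm sigma s (commutator (Ahat_t kappa H A w t) K0) =
  fisher_form mode_weight mode_gap bohr mode_part beta kappa s w t.
Proof.
set X := commutator _ _; set Y := U *m X *m U^t*.
have XE : X = U^t* *m Y *m U by exact: (unitary_conjK X Uu).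
rewrite /sqnorm !(mxpow_stateE sigma_state).
have XcE : X^t* = U^t* *m Y^t* *m U by rewrite XE !trCM trmxCK mulmxA.
rewrite XcE [in X in _ *m X *m _]XE !(unitary_conjM _ _ Uu) (mxtrace_unitary _ Uu).
rewrite Re_tr_weighted /fisher_form /quad /amp.
transitivity (\sum_(k : 'I_n * 'I_n * bool)
  (expR ((x k.1.1 + x k.1.2) / 2) * expR (s * (x k.1.1 - x k.1.2))) *
  (\sum_p mode_part k p t * (th k.1 p * gaussian kappa (w - bohr p))) ^+ 2); last first.
  apply: eq_bigr => k _; congr (_ * _ ^+ 2); apply: eq_bigr => p _.
  by rewrite mulrA.
rewrite (sum_mode_part (fun ij => expR ((x ij.1 + x ij.2) / 2) * expR (s * (x ij.1 - x ij.2)))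
  (fun ij p => th ij p * gaussian kappa (w - bohr p))) /=.
apply: eq_bigr => i _; apply: eq_bigr => j _; congr (_ * _).
  by rewrite -!expRD; congr expR; rewrite -/(x i) -/(x j); field.
rewrite /Y /X Ahat_tE commutator_entry sqmN; congr sqm.
apply: eq_bigr => p _; rewrite [(\matrix_(_, _) _) _ _]mxE /mode /=.
exact: etrans (entry_ring2 _ _ _ _ _ _) (congr1 ( *%R _) (esym (realCM _ _))).
Qed.

Let realC_lin (a b c d e f : R) : a - b * (c * d) = - (e * f) ->
  a%:C - b%:C * (c%:C * d%:C) = - (e%:C * f%:C) :> C.
Proof. by move=> h; rewrite -!rmorphM -rmorphB h rmorphN. Qed.

Let entry_ring (a b c d g sj si lm lp cq y : C) :
  sj - si * (lm * lp) = - (cq * y) ->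
  a * (b * g * d) * c * sj - si * (a * (lm * (b * g * d) * lp) * c) =
  - (cq * (a * b * c * d * (y * g))).
Proof.
move=> h; transitivity (a * b * c * d * g * (sj - si * (lm * lp))); first by ring.
by rewrite h; ring.
Qed.

Lemma balance_link (w t : R) :
  hsnorm (Ahat_t kappa H A w t *m mxpow sigma 2^-1
    - mxpow sigma 2^-1 *m (mxpow (gibbs beta H) (- 2^-1)
        *m Ahat_t kappa H A w t *m mxpow (gibbs beta H) 2^-1)) ^+ 2 =
  balance_form mode_weight mode_gap bohr mode_part beta kappa w t.
Proof.
rewrite hsnorm_sqr -(hs2_unitary_conj _ Uu) Ahat_tE.
set M := \matrix_(_, _) _.
rewrite !mxpow_gibbsE !(unitary_conjM _ _ Wu) (mxpow_stateE sigma_state).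
have UU := unitary_trCr Uu.
rewrite mulmxBr mulmxBl (basis_r _ _ UU) (basis_l _ _ UU) !change_basis -/T.
rewrite /balance_form /quad.
set lz := ln (partition_sum beta H).
pose y (ij p : 'I_n * 'I_n) := expR (beta * bohr p / 4) *
  (expR (th ij p / 4) - expR (- (th ij p / 4))) * gaussian kappa (w - bohr p).
transitivity (\sum_(k : 'I_n * 'I_n * bool) expR ((x k.1.1 + x k.1.2) / 2) *
  (\sum_p mode_part k p t * y k.1 p) ^+ 2); last first.
  apply: eq_bigr => k _; congr (_ * _ ^+ 2); apply: eq_bigr => p _.
  by rewrite -[RHS]mulrA.
rewrite (sum_mode_part (fun ij => expR ((x ij.1 + x ij.2) / 2)) y) /hs2.
apply: eq_bigr => i _; apply: eq_bigr => j _.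
rewrite mxBE mulmx_dg mul_dg !mulmx_sandwichE.
pose cq := expR ((x i + x j) / 4).
have cq2 : cq ^+ 2 = expR ((x i + x j) / 2).
  by rewrite /cq expr2 -expRD; congr expR; field.
pose y1 (p : 'I_n * 'I_n) := expR (beta * bohr p / 4) *
  (expR (th (i, j) p / 4) - expR (- (th (i, j) p / 4))).
(* Both terms equal cq exp(beta nu / 4) times exp(-theta/4) and exp(theta/4) respectively; the
   powers of the partition sum cancel. *)
have coef (p : 'I_n * 'I_n) : expR (2^-1 * x j) - expR (2^-1 * x i) *
    (expR (- 2^-1 * (- beta * E p.1 - lz)) * expR (2^-1 * (- beta * E p.2 - lz))) =
    - (cq * y1 p).
  have e1 : cq * (expR (beta * bohr p / 4) * expR (th (i, j) p / 4)) =
     expR (2^-1 * x i) * (expR (- 2^-1 * (- beta * E p.1 - lz)) *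
     expR (2^-1 * (- beta * E p.2 - lz))).
    by rewrite /cq -!expRD; congr expR; rewrite /th /bohr /=; field.
  have e2 : cq * (expR (beta * bohr p / 4) * expR (- (th (i, j) p / 4))) = expR (2^-1 * x j).
    by rewrite /cq -!expRD; congr expR; rewrite /th /bohr /=; field.
  have -> : cq * y1 p = cq * (expR (beta * bohr p / 4) * expR (th (i, j) p / 4)) -
      cq * (expR (beta * bohr p / 4) * expR (- (th (i, j) p / 4))).
    by rewrite /y1 -mulrBr -mulrBr.
  by rewrite e1 e2 opprB.
rewrite (_ : _ - _ = - (cq%:C * \sum_p mode (i, j) p t * (y1 p * gaussian kappa (w - bohr p))%:C)).
  by rewrite sqmN sqmM sqm_realC cq2.
rewrite [in LHS]mulr_suml [in LHS]mulr_sumr -sumrB [in RHS]mulr_sumr -sumrN.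
apply: eq_bigr => p _; rewrite mulmx_dg mul_dg.
have -> : M p.1 p.2 = A' p.1 p.2 * (gaussian kappa (w - bohr p))%:C * cis (bohr p * t).
  by rewrite [LHS]mxE.
have cC := realC_lin (coef p).
rewrite /mode /= (realCM (y1 p)).
by apply: entry_ring; exact: cC.
Qed.

Definition drive (t : R) : 'M[C]_n := evol H t *m A *m evol H (- t).

Let evol_trC t : (evol H t)^t* = evol H (- t).
Proof.
rewrite !evolE !trCM trmxCK trC_dg mulmxA.
rewrite (@eq_dg _ _ _ (fun a => cis (E a * - t))) // => a.
by rewrite conj_cis mulrN.
Qed.

Let evol_unitary t : evol H t \is unitarymx.
Proof.
apply/unitarymxP; rewrite evol_trC !evolE (unitary_conjM _ _ Wu) dgM.
rewrite (@eq_dg _ _ _ (fun=> 1)); last first.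
  by move=> a; rewrite -cisD mulrN subrr cis0.
rewrite (_ : dg _ = 1%:M) ?mulmx1 ?(unitary_trCl Wu) //.
by apply/matrixP => a b; rewrite !mxE.
Qed.

Let driveE t : drive t = W^t* *m (\matrix_(a, b) (A' a b * cis ((E a - E b) * t))) *m W.
Proof.
rewrite /drive [X in _ *m X *m _](unitary_conjK A Wu) !evolE !(unitary_conjM _ _ Wu).
congr (_ *m _ *m _); apply/matrixP => a b; rewrite mulmx_dg mul_dg [RHS]mxE.
rewrite mulrBl cisD -mulrN -/A'; move: (A' a b) => u; ring.
Qed.

Let drive_herm t : (drive t)^t* = drive t.
Proof.
have Ah : A^t* = A by apply/esym/eqP; rewrite -hermsymmx_trC.
have h1 := evol_trC t.
have h2 := etrans (evol_trC (- t)) (congr1 (evol H) (opprK t)).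
by rewrite /drive (trCM (evol H t *m A)) h2 (trCM (evol H t)) h1 Ah mulmxA.
Qed.

Let trC_conj_real (P : 'M[C]_n) (f : 'I_n -> R) :
  (P^t* *m dg (fun i => (f i)%:C) *m P)^t* = P^t* *m dg (fun i => (f i)%:C) *m P.
Proof.
rewrite trCM trCM trmxCK trC_dg mulmxA.
rewrite (@eq_dg _ _ (fun i => Num.conj (f i)%:C) (fun i => (f i)%:C)) // => i.
exact: conjC_realC.
Qed.

Let trCB (X Y : 'M[C]_n) : (X - Y)^t* = X^t* - Y^t*.
Proof. by rewrite raddfB /= map_mxB. Qed.

Let K0_herm : K0^t* = K0.
Proof.
rewrite trCB mxln_stateE mxln_gibbsE.
exact: (congr2 (fun X Y => X - Y) (trC_conj_real _ _) (trC_conj_real _ _)).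
Qed.

(** The squared (sigma, s)-norm of the commutator of the unfiltered [drive t] with [K0]. *)
Let F s t := \sum_i \sum_j (expR ((x i + x j) / 2) * expR (s * (x i - x j))) *
  sqm (\sum_p mode (i, j) p t * (th (i, j) p)%:C).

Let scale_sqr_le (a b k v : R) : 0 <= a -> a <= b -> 0 <= k -> 0 <= v ->
  4 * (a ^+ 2 * k) * v <= 4 * (b ^+ 2 * k) * v.
Proof.
move=> a0 ab k0 v0; apply: ler_wpM2r => //; apply: ler_wpM2l => //.
by apply: ler_wpM2r => //; rewrite lerXn2r ?nnegrE ?(le_trans a0).
Qed.

Let half_le (a b d : R) : a <= d -> b <= d -> (a + b) / 2 <= d.
Proof. by move=> *; lra. Qed.

Let swap4 (u y d h : C) : u * y * h * d = u * (y * d) * h.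
Proof. by ring. Qed.

(** [drive t] is a unitary conjugate of A, hence of no larger operator norm, and its commutator with
    the Hermitian [K0] is skew-Hermitian, as [sum_interpolated_weights_le] asks for. *)
Let F_le s t : - 2^-1 <= s <= 2^-1 -> F s t <= 4 * (opnorm A ^+ 2 * opnorm K0 ^+ 2).
Proof.
move=> sD; set X := commutator (drive t) K0.
have Xskew : X^t* = - X.
  rewrite /X /commutator trCB (trCM (drive t)) (trCM K0) drive_herm K0_herm.
  by rewrite opprB.
have HX (v : 'cV[C]_n) : hs2 (X *m v) <= 4 * (opnorm A ^+ 2 * opnorm K0 ^+ 2) * hs2 v.
  apply: le_trans (hs2_commutator_le _ _ _) _.
  have h : opnorm (evol H t *m A *m (evol H t)^t*) <= opnorm A.
    exact: opnorm_unitary_conj A (evol_unitary t).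
  rewrite (evol_trC t) in h.
  exact: scale_sqr_le (opnorm_ge0 _) h (sqr_ge0 _) (hs2_ge0 v).
apply: le_trans (sum_interpolated_weights_le Uu Xskew HX (expR_ln_state_sum sigma_state) sD).
rewrite le_eqVlt; apply/orP; left; apply/eqP.
apply: eq_bigr => i _; apply: eq_bigr => j _; congr (_ * _).
rewrite /X driveE commutator_entry sqmN; congr sqm; apply: eq_bigr => p _.
rewrite [(\matrix_(_, _) _) _ _]mxE /mode /bohr /=.
by move: (T _ _) (A' _ _) (Num.conj _) (cis _) => a b c d; ring.
Qed.

(** A phase exp(i bohr(p) tau) on mode p moves the time from t to t + tau. By the parallelogram law
    the left side is the mean of F at t + tau and t - tau, which explains the uniformity in tau. *)
Lemma mode_amp_le (s t tau : R) : - 2^-1 <= s <= 2^-1 ->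
  \sum_k amp mode_weight mode_gap s k *
    ((\sum_p mode_part k p t * theta mode_gap bohr beta k p * cos (bohr p * tau)) ^+ 2 +
     (\sum_p mode_part k p t * theta mode_gap bohr beta k p * sin (bohr p * tau)) ^+ 2)
  <= 4 * (opnorm A ^+ 2 * opnorm K0 ^+ 2).
Proof.
move=> sD.
pose a (ij : 'I_n * 'I_n) := expR ((x ij.1 + x ij.2) / 2) * expR (s * (x ij.1 - x ij.2)).
rewrite [leLHS](_ : _ = (F s (t + tau) + F s (t - tau)) / 2).
  exact: half_le (F_le _ sD) (F_le _ sD).
transitivity (\sum_k a k.1 * (\sum_p mode_part k p t * (th k.1 p * cos (bohr p * tau))) ^+ 2 +
  \sum_k a k.1 * (\sum_p mode_part k p t * (th k.1 p * sin (bohr p * tau))) ^+ 2).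
  rewrite -big_split /=; apply: eq_bigr => k _; rewrite -mulrDr; congr (_ * (_ ^+ 2 + _ ^+ 2)).
    by apply: eq_bigr => p _; rewrite mulrA.
  by apply: eq_bigr => p _; rewrite mulrA.
rewrite (sum_mode_part a (fun ij p => th ij p * cos (bohr p * tau))).
rewrite (sum_mode_part a (fun ij p => th ij p * sin (bohr p * tau))).
rewrite /F -!big_split /= mulr_suml; apply: eq_bigr => i _.
rewrite -!big_split /= mulr_suml; apply: eq_bigr => j _.
rewrite -!mulrDr -[RHS]mulrA; congr (_ * _).
pose z p := mode (i, j) p t * (th (i, j) p)%:C.
transitivity (sqm (\sum_p z p * (cos (bohr p * tau))%:C) + sqm (\sum_p z p * (sin (bohr p * tau))%:C)).
  by congr (sqm _ + sqm _); apply: eq_bigr => p _; rewrite rmorphM mulrA.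
rewrite sqm_sum_cos_sin; congr ((sqm _ + sqm _) / _); apply: eq_bigr => p _.
  have cd : cis (bohr p * (t + tau)) = cis (bohr p * t) * cis (bohr p * tau) :> C.
    by rewrite mulrDr cisD.
  rewrite /z /mode cd; exact: swap4.
have cd : cis (bohr p * (t - tau)) = cis (bohr p * t) * cis (- (bohr p * tau)) :> C.
  by rewrite mulrBr cisD.
rewrite /z /mode cd; exact: swap4.
Qed.

Lemma measurable_mode_part k p : measurable_fun setT (mode_part k p).
Proof.
pose z := T k.1.1 p.1 * A' p.1 p.2 * Num.conj (T k.1.2 p.2).
have cl (t : R) : {for t, continuous (fun t : R => bohr p * t)}.
  by apply: cvgMl_tmp; exact: cvg_id.
have cc : continuous (fun t => cos (bohr p * t)).
  by move=> t; apply: continuous_comp; [exact: cl|exact: continuous_cos].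
have cs : continuous (fun t => sin (bohr p * t)).
  by move=> t; apply: continuous_comp; [exact: cl|exact: continuous_sin].
apply: continuous_measurable_fun; rewrite /mode_part; case: k.2.
  rewrite (_ : (fun t => _) = fun t => Re z * sin (bohr p * t) + Im z * cos (bohr p * t)).
    by move=> t; apply: cvgD; apply: cvgMl_tmp; [exact: cs|exact: cc].
  by apply/funext => t; rewrite /mode complexImM.
rewrite (_ : (fun t => _) = fun t => Re z * cos (bohr p * t) - Im z * sin (bohr p * t)).
  by move=> t; apply: cvgB; apply: cvgMl_tmp; [exact: cc|exact: cs].
by apply/funext => t; rewrite /mode complexReM.
Qed.
End Model.

(** * Optimizing the cutoff *)

Section Optimization.
Context {R : realType}.

(** Since e^{1/5} >= 6/5 and (6/5)^4 > 2. A bound below 1 keeps 1 + ln(M/f) away from 0 when f <=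
    2M. *)
Lemma ln2_le : ln 2 <= 4 / 5 :> R.
Proof.
rewrite -ler_expR lnK ?posrE //.
have e1 : 6 / 5 <= expR (5^-1 : R).
  by apply: le_trans (expR_ge1Dx _); lra.
have -> : expR (4 / 5 : R) = expR 5^-1 * expR 5^-1 * (expR 5^-1 * expR 5^-1).
  by rewrite -!expRD; congr expR; field.
have e2 : 36 / 25 <= expR (5^-1 : R) * expR 5^-1 by nra.
by nra.
Qed.

Lemma weight_mass_le (d : R) : 0 < d -> weight_mass d <= ln ((2 + d) / d) / 2.
Proof.
move=> d0; rewrite /weight_mass ler_wpM2l //.
  by rewrite ln_ge0 // ler_pdivlMr // mul1r lerDr.
by rewrite lef_pV2 ?posrE ?mulr_gt0 //; lra.
Qed.

(** For f > 0 the choice d = f/M makes the two terms comparable. For f = 0 no such d exists, and d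
    is sent to 0, using that d ln(1/d) tends to 0. *)
Lemma optimize_cutoff (a f : \bar R) (M : R) :
  0 <= M -> (0 <= f)%E -> (f <= (2 * M)%:E)%E ->
  (forall d : R, 0 < d -> (a <= (weight_mass d)%:E * f +
     (weight_mass d * (d / 2 + d ^+ 2 / 4) * (2 * M))%:E)%E) ->
  (a <= if f == 0 then 0 else 6%:E * f * (1 + lne (M%:E / f)))%E.
Proof.
move=> M0; case: f => [r| |] r0 rM ha; last 2 first.
- by move: rM; rewrite leye_eq.
- by move: r0; rewrite leeNy_eq.
rewrite lee_fin in r0; rewrite lee_fin in rM.
case: eqVneq => [[rz]|rn0].
  apply/lee_addgt0Pr => e e0; rewrite add0e.
  pose m : R := 1 + 4 * M / e.
  have m1 : 1 <= m by rewrite lerDl divr_ge0 ?mulr_ge0 // ltW.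
  have m0 : 0 < m by lra.
  (* Then (2 + d)/d = m^2 + 1 <= (1 + m)^2, so [weight_mass d] is at most ln(1 + m) <= m, and m d 2M
     = 4M/m <= e. *)
  pose d : R := 2 / m ^+ 2.
  have d0 : 0 < d by rewrite divr_gt0 ?exprn_gt0.
  apply: le_trans (ha d d0) _; rewrite rz mule0 add0e lee_fin.
  have wm : weight_mass d <= m.
    apply: le_trans (weight_mass_le d0) _.
    have -> : (2 + d) / d = m ^+ 2 + 1 by rewrite /d; field; rewrite gt_eqF.
    have : ln (m ^+ 2 + 1) <= ln ((1 + m) * (1 + m)).
      by rewrite ler_ln ?posrE; nra.
    rewrite lnM ?posrE; [|lra|lra].
    have := @le_ln1Dx R m; rewrite (lt_trans _ m0) ?ltrN10 //.
    by move=> /(_ isT); lra.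
  have d2 : d <= 2.
    by rewrite /d ler_pdivrMr ?exprn_gt0 //; nra.
  have dd : d / 2 + d ^+ 2 / 4 <= d by nra.
  have w0 := weight_mass_gt0 d0.
  apply: (@le_trans _ _ (m * d * (2 * M))).
    apply: ler_wpM2r; first by lra.
    by apply: ler_pM => //; [exact: ltW|rewrite addr_ge0 ?divr_ge0 ?sqr_ge0 // ltW].
  have -> : m * d * (2 * M) = 4 * M / m by rewrite /d; field; rewrite gt_eqF.
  rewrite ler_pdivrMr // /m mulrDr mulr1 mulrCA divff ?mulr1 ?gt_eqF //.
  by rewrite lerDr ltW.
have rp : 0 < r.
  rewrite lt_def r0 andbT; apply: contra rn0 => /eqP ->; exact: eqxx.
have Mp : 0 < M by lra.
pose d := r / M.
have d0 : 0 < d by rewrite divr_gt0.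
have d2 : d <= 2 by rewrite /d ler_pdivrMr.
rewrite inver gt_eqF // -EFinM lne_EFin ?divr_gt0 // -EFinD -!EFinM.
apply: le_trans (ha d d0) _; rewrite -EFinM -EFinD lee_fin.
set y := ln (M / r).
have y1 : - (4 / 5) <= y.
  have : ln 2^-1 <= y.
    by rewrite /y ler_ln ?posrE ?divr_gt0 ?invr_gt0 // ler_pdivlMr // mulrC; lra.
  by rewrite lnV ?posrE //; have := ln2_le; lra.
have q0 : 0 < M / r by rewrite divr_gt0.
have t4 : (0 : R) < 2 * 2 by rewrite mulr_gt0.
have e4 : ln (2 * 2 * (M / r)) = ln 2 + ln 2 + y.
  apply: etrans (@lnM R (2 * 2) (M / r) _ _) _; rewrite ?posrE //.
  by congr (_ + _); apply: (@lnM R 2 2); rewrite posrE.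
have h4 : (2 + d) / d <= 2 * 2 * (M / r).
  have -> : M / r = d^-1 by rewrite /d invf_div.
  by rewrite ler_pM2r ?invr_gt0 //; lra.
have h5 : ln ((2 + d) / d) <= ln 2 + ln 2 + y.
  have p1 : 0 < (2 + d) / d by rewrite divr_gt0 // addr_gt0.
  have p2 : 0 < 2 * 2 * (M / r) by rewrite mulr_gt0.
  by rewrite -e4 ler_ln ?posrE.
have wm : weight_mass d <= (8 / 5 + y) / 2.
  apply: le_trans (weight_mass_le d0) _; rewrite ler_pM2r ?invr_gt0 //.
  by apply: le_trans h5 _; have := ln2_le; lra.
have w0 := weight_mass_gt0 d0.
(* As d M = r, the error term is [weight_mass d] times r + r d/2; with d <= 2 the total factor is at
   most 3r. *)
have -> : weight_mass d * r + weight_mass d * (d / 2 + d ^+ 2 / 4) * (2 * M) =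
    weight_mass d * (r * (2 + d / 2)).
  by rewrite /d; move: (weight_mass _) => w; field; rewrite gt_eqF.
apply: (@le_trans _ _ ((8 / 5 + y) / 2 * (r * 3))).
  apply: ler_pM => //; first exact: ltW.
    by rewrite mulr_ge0 // ?addr_ge0 // ?divr_ge0 // ltW.
  by rewrite ler_pM2l //; lra.
(* After division by r > 0 this is (3/2)(8/5 + y) <= 6 (1 + y), that is y >= -4/5, with equality at
   -4/5: this is where the constant 6 comes from. *)
nra.
Qed.
End Optimization.

Theorem theoremC1 (R : realType) :
  exists c : R, (0 < c)%R /\
  forall (n : nat) (beta kappa : R) (H A sigma : 'M[R[i]]_(2 ^ n)),
    (0 < beta)%R ->
    (0 < kappa)%R -> (kappa <= beta^-1)%R ->
    H \is hermsymmx ->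
    A \is hermsymmx ->
    full_rank_state sigma ->
    (ADB beta kappa H A sigma <=
     if FI beta kappa H A sigma == 0 then 0 else
     c%:E * FI beta kappa H A sigma *
       (1 + lne ((opnorm (mxln sigma - mxln (gibbs beta H)) ^+ 2
                  * opnorm A ^+ 2)%R%:E / FI beta kappa H A sigma)))%E.
Proof.
exists 6; split=> // n beta kappa H A sigma beta_gt0 kappa_gt0 _ _ A_herm sigma_state.
set M := opnorm _ ^+ 2 * opnorm A ^+ 2.
have inD s : `[(- 2^-1 : R), (2^-1 : R)]%classic s -> - 2^-1 <= s <= 2^-1.
  by rewrite /= in_itv.
have mode_le (s t tau : R) (sD : `[(- 2^-1 : R), (2^-1 : R)]%classic s) :=
  mode_amp_le beta H A_herm sigma_state t tau (inD s sD).
have mode_measurable := measurable_mode_part H A sigma.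
have weight_ge0 k : 0 <= mode_weight sigma k by exact: expR_ge0.
have FIE : FI beta kappa H A sigma = (\int[lebesgue_measure]_t \int[lebesgue_measure]_w
    \int[lebesgue_measure]_(s in `[(- 2^-1 : R)%R, (2^-1 : R)%R])
    (fisher_density (mode_weight sigma) (mode_gap sigma) (bohr H)
      (mode_part H A sigma) beta kappa t w s)%:E)%E.
  apply: eq_integral => t _; apply: eq_integral => w _; apply: eq_integral => s _.
  by rewrite fisher_link.
have ADBE : ADB beta kappa H A sigma = (\int[lebesgue_measure]_t \int[lebesgue_measure]_w
    (balance_density (mode_weight sigma) (mode_gap sigma) (bohr H)
      (mode_part H A sigma) beta kappa t w)%:E)%E.
  apply: eq_integral => t _; apply: eq_integral => w _.
  by rewrite balance_link.
(* The 4 is the square of the 2 in the commutator bound 2 |X| |Y|; the division by 2 is the bound on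
   the masses of g and g_s. *)
have BE : 4 * (opnorm A ^+ 2 * opnorm (mxln sigma - mxln (gibbs beta H)) ^+ 2) / 2 = 2 * M.
  by rewrite /M mulrC; move: (opnorm A) (opnorm _) => a b; field.
apply: optimize_cutoff.
- by rewrite /M mulr_ge0 ?sqr_ge0.
- rewrite FIE; apply: integral_ge0 => t _; apply: integral_ge0 => w _.
  by apply: integral_ge0 => s sD; rewrite lee_fin fisher_density_ge0.
- rewrite FIE -BE; exact: (integral2_fisher_density_le beta_gt0 kappa_gt0 weight_ge0 mode_measurable mode_le).
- move=> d d_gt0; rewrite FIE ADBE -BE (mulrA (weight_mass d * _)).
  exact: (integral2_balance_density_le beta_gt0 kappa_gt0 weight_ge0 mode_measurable mode_le d_gt0).
Qed.
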